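(* Let $G$ be a finite group, $k$ a field of characteristic $p$ dividing $|G|$, and $H\subset G$ a subgroup such that $p$ divides $|H|$. Take the Krull dimension as a dimension function for $kG\text{-stab}$ and $kH\text{-stab}$. Then the stable restriction functor $\underline{\operatorname{Res}}^G_H:kG\text{-stab}\to kH\text{-stab}$ has relative dimension $0$.
   Context: A tensor triangulated category $\mathcal{K}$ is an essentially small triangulated category with a symmetric monoidal structure $(\otimes,\mathbb{I})$ such that $\otimes$ is exact in each variable. A prime ideal of $\mathcal{K}$ is a proper thick triangulated subcategory $\mathcal{P}$ with $\mathcal{K}\otimes\mathcal{P}\subset\mathcal{P}$ such that $A\otimes B\in\mathcal{P}$ implies $A\in\mathcal{P}$ or $B\in\mathcal{P}$. $\operatorname{Spc}(\mathcal{K})$ is the set of prime ideals, topologized by the basis of closed sets $\operatorname{supp}(A)=\{\mathcal{P}: A\notin\mathcal{P}\}$, $A\in\mathcal{K}$. The Krull dimension $\dim_{\mathrm{Krull}}(\mathcal{P})$ of $\mathcal{P}\in\operatorname{Spc}(\mathcal{K})$ is the maximal length $n$ of a chain of non-empty irreducible closed subsets $C_0\subsetneq\dots\subsetneq C_n=\overline{\{\mathcal{P}\}}$; for $V\subset\operatorname{Spc}(\mathcal{K})$, $\dim(V)=\sup_{\mathcal{P}\in V}\dim_{\mathrm{Krull}}(\mathcal{P})$ (so $\dim\emptyset=-\infty$), and for $l\in\mathbb{Z}$, $\mathcal{K}_{(l)}\subset\mathcal{K}$ is the full subcategory of objects $a$ with $\dim(\operatorname{supp}(a))\le l$. An exact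 functor $F:\mathcal{K}\to\mathcal{L}$ has relative dimension $n\in\mathbb{Z}$ if $F(\mathcal{K}_{(l)})\subset\mathcal{L}_{(l+n)}$ for all $l$ and $n$ is the smallest integer with this property. For a finite group $\Gamma$, $k\Gamma\text{-stab}$ is the stable category of the Frobenius category of finitely generated left $k\Gamma$-modules; it is a tensor triangulated category with tensor product induced by $\otimes_k$ (diagonal action) and unit $k$. $\underline{\operatorname{Res}}^G_H$ is the exact functor induced on stable categories by the restriction functor $\operatorname{Res}^G_H$, which is exact and preserves projectives. *)

(* Defs.v *)
From HB Require Import structures.
From mathcomp Require Import all_boot all_order all_algebra.
From mathcomp Require Import all_fingroup all_character.
From mathcomp Require Import boolp classical_sets constructive_ereal topology.

Set Implicit Arguments.
Unset Strict Implicit.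
Unset Printing Implicit Defensive.

Import Order.TTheory GRing.Theory Num.Theory.

Local Open Scope ring_scope.

(* The structure carried by a tensor triangulated category: Hom groups,
   composition, shift functor, distinguished triangles, and the objects of the
   monoidal structure. The axioms, and the action of the tensor product on
   morphisms, play no role in the definition of the spectrum, of supports or of
   relative dimension, and are not bundled. *)
Record ttCat := TTCat {
  tt_ob :> Type;
  tt_hom : tt_ob -> tt_ob -> zmodType;
  tt_id : forall A, tt_hom A A;
  tt_comp : forall A B C, tt_hom B C -> tt_hom A B -> tt_hom A C;
  tt_shift : tt_ob -> tt_ob;
  tt_shiftm : forall A B, tt_hom A B -> tt_hom (tt_shift A) (tt_shift B);
  tt_triangle : forall A B C, tt_hom A B -> tt_hom B C -> tt_hom C (tt_shift A) -> Prop;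
  tt_tensor : tt_ob -> tt_ob -> tt_ob;
  tt_unit : tt_ob }.

Arguments tt_id {t} A.
Arguments tt_comp {t A B C} g f.
Arguments tt_shift {t} A.
Arguments tt_shiftm {t A B} f.
Arguments tt_triangle {t A B C} u v w.
Arguments tt_tensor {t} A B.

Section Spectrum.
Local Open Scope classical_set_scope.
Variable K : ttCat.

Definition is_iso (A B : K) (f : tt_hom A B) : Prop :=
  exists g : tt_hom B A, tt_comp g f = tt_id A /\ tt_comp f g = tt_id B.

Definition is_biproduct (A B S : K) : Prop :=
  exists (i1 : tt_hom A S) (i2 : tt_hom B S) (p1 : tt_hom S A) (p2 : tt_hom S B),
  [/\ tt_comp p1 i1 = tt_id A, tt_comp p2 i2 = tt_id B, tt_comp p1 i2 = 0, tt_comp p2 i1 = 0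
    & tt_comp i1 p1 + tt_comp i2 p2 = tt_id S].

Record thick_subcategory (P : set K) : Prop := ThickSubcategory {
  thick_zero : forall A, tt_id A = 0 -> P A;
  thick_iso : forall A B (f : tt_hom A B), is_iso f -> P A -> P B;
  thick_shift : forall A, P (tt_shift A) <-> P A;
  thick_triangle : forall A B C (u : tt_hom A B) (v : tt_hom B C) w,
    tt_triangle u v w ->
    [/\ P A -> P B -> P C, P B -> P C -> P A & P A -> P C -> P B];
  thick_summand : forall A B S, is_biproduct A B S -> P S -> P A /\ P B }.

Record prime_ideal (P : set K) : Prop := PrimeIdeal {
  prime_thick : thick_subcategory P;
  prime_proper : P <> setT;
  prime_tensor : forall A B, P B -> P (tt_tensor A B);
  prime_prime : forall A B, P (tt_tensor A B) -> P A \/ P B }.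

Record Spc := MkSpc { Spc_set :> set K; Spc_prime : prime_ideal Spc_set }.

HB.instance Definition _ := gen_eqMixin Spc.
HB.instance Definition _ := gen_choiceMixin Spc.

Definition supp (A : K) : set Spc := [set P : Spc | ~ (P : set K) A].

(* The coarsest topology in which every supp A is closed. The sets
   ~` supp A = [set P | P A] form a basis and not only a subbasis when K is
   tensor triangulated: ~` supp A `&` ~` supp B = ~` supp (A (+) B) and
   ~` supp 0 = setT. *)
HB.instance Definition _ :=
  isSubBaseTopological.Build Spc [set ~` supp A | A in [set: K]] id.

End Spectrum.

Section KrullDimension.
Local Open Scope classical_set_scope.

Definition irreducible_set (T : topologicalType) (C : set T) : Prop :=
  C !=set0 /\ forall F1 F2, closed F1 -> closed F2 ->
    C `<=` F1 `|` F2 -> C `<=` F1 \/ C `<=` F2.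

Definition irreducible_chain (T : topologicalType) (n : nat)
    (C : nat -> set T) : Prop :=
  (forall i, (i <= n)%N -> closed (C i) /\ irreducible_set (C i)) /\
  (forall i, (i < n)%N -> C i `<` C i.+1).

(* The largest length of a chain, +oo if the lengths are unbounded. In
   [\bar int] every set of dimensions has a supremum; the default value -oo of
   [supremum] is therefore only used for the empty set. *)
Definition krull_dim (T : topologicalType) (x : T) : \bar int :=
  supremum -oo%E [set (n%:Z)%:E | n in
    [set n | exists2 C, irreducible_chain n C & C n = closure [set x]]].

Definition set_dim (T : topologicalType) (V : set T) : \bar int :=
  supremum -oo%E [set krull_dim x | x in V].

Definition dim_le (K : ttCat) (l : int) : set K :=
  [set A | (set_dim (supp A) <= l%:E)%E].

End KrullDimension.

Arguments dim_le K l : clear implicits.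

Record exact_functor (K L : ttCat) := ExactFunctor {
  fob :> K -> L;
  fmor : forall A B, tt_hom A B -> tt_hom (fob A) (fob B);
  fmorD : forall A B (f g : tt_hom A B), fmor (f + g) = fmor f + fmor g;
  fmor1 : forall A, fmor (tt_id A) = tt_id (fob A);
  fmorM : forall A B C (g : tt_hom B C) (f : tt_hom A B),
    fmor (tt_comp g f) = tt_comp (fmor g) (fmor f);
  fshift : forall A, tt_hom (fob (tt_shift A)) (tt_shift (fob A));
  fshift_iso : forall A, is_iso (fshift A);
  fshift_nat : forall A B (f : tt_hom A B),
    tt_comp (fshift B) (fmor (tt_shiftm f)) = tt_comp (tt_shiftm (fmor f)) (fshift A);
  ftriangle : forall A B C (u : tt_hom A B) (v : tt_hom B C) (w : tt_hom C (tt_shift A)),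
    tt_triangle u v w ->
    tt_triangle (fmor u) (fmor v) (tt_comp (fshift A) (fmor w)) }.

Definition dim_shift (K L : ttCat) (F : exact_functor K L) (n : int) : Prop :=
  forall (l : int) (A : K), dim_le K l A -> dim_le L (l + n) (F A).

Definition has_relative_dimension (K L : ttCat) (F : exact_functor K L)
    (n : int) : Prop :=
  dim_shift F n /\ forall m : int, dim_shift F m -> n <= m.

Section Tprod.
Variable k : fieldType.

Lemma trow_mulr (m1 m2 n2 p2 : nat) (A : 'rV[k]_m1) (B1 : 'M_(m2, n2))
  (B2 : 'M_(n2, p2)) : trow A (B1 *m B2) = B1 *m trow A B2.
Proof.
elim: m1 A => [|m1 IH] A /=; first by rewrite mulmx0.
by rewrite IH mul_mx_row -scalemxAr.
Qed.

Lemma trow_tprod n1 p1 (a : 'rV[k]_n1) (R : 'M_(n1, p1)) m2 n2 p2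
  (B : 'M_(m2, n2)) (S : 'M_(n2, p2)) :
  trow a B *m tprod R S = trow (a *m R) (B *m S).
Proof.
have /= := tprodE (a : 'M_(1, n1)) R B S.
rewrite mul_col_mx => /eq_col_mx[].
have u_id q (A : 'M[k]_(1 + 0, q)) : usubmx A = A :> 'M_(1, q).
  by apply/matrixP=> i j; rewrite mxE; congr (A _ _); apply: val_inj.
by rewrite !u_id => ->.
Qed.

Lemma tprodDl m1 n1 m2 n2 (A B : 'M[k]_(m1, n1)) (C : 'M_(m2, n2)) :
  tprod (A + B) C = tprod A C + tprod B C.
Proof.
elim: m1 n1 A B => [|m1 IH] n1 A B /=; first by rewrite addr0.
rewrite add_col_mx -IH linearD -!trowbE !linearD /=; congr col_mx.
Qed.

Lemma tprod_sum (I : Type) (s : seq I) (P : pred I) m1 n1 m2 n2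
  (A : I -> 'M[k]_(m1, n1)) (C : 'M_(m2, n2)) :
  tprod (\sum_(i <- s | P i) A i) C = \sum_(i <- s | P i) tprod (A i) C.
Proof.
apply: (big_morph (fun M => tprod M C)) => [M N|]; first exact: tprodDl.
apply: (addrI (tprod (0 : 'M_(m1, n1)) C)); rewrite -tprodDl !addr0 //.
Qed.

Lemma trow_eq0 n1 m2 n2 (a : 'rV[k]_n1) (B : 'M_(m2, n2)) :
  a != 0 -> trow a B = 0 -> B = 0.
Proof.
elim: n1 a => [|n1 IH] a; first by rewrite [a]thinmx0 eqxx.
move=> a0 /= /eqP; rewrite row_mx_eq0 => /andP[/eqP B0 /eqP C0].
have [l0|l0] := eqVneq (lsubmx (a : 'M_(1, 1 + n1)) 0 0) 0; last first.
  by move: B0 => /eqP; rewrite scalemx_eq0 (negPf l0) => /eqP.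
apply: IH C0; apply: contraNneq a0 => r0.
rewrite -[a](@hsubmxK _ 1 1 n1) r0 [lsubmx _]mx11_scalar l0 raddf0.
by rewrite (@row_mx0 _ 1 1 n1).
Qed.

End Tprod.

Section Modules.
Variables (k : fieldType) (gT : finGroupType) (G : {group gT}).
Local Notation kGmod := (representation k G).
Implicit Types M N P : kGmod.

(* A representation M, in the row vector convention of mxrepresentation, is the
   left kG-module with underlying space 'rV_(rdegree M) and action
   g . v = v *m M g^-1. Every finitely generated left kG-module is of this form
   up to isomorphism, and kG-linear maps M -> N are the maps v |-> v *m f with f
   as follows. Composition is thus the product in the reverse order. *)
Definition equivariant M N :=
  [qualify a f : 'M[k]_(rdegree M, rdegree N) |
    [forall x in G, M x *m f == f *m N x]].

Lemma equivariantP M N (f : 'M_(rdegree M, rdegree N)) :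
  reflect {in G, forall x, M x *m f = f *m N x} (f \is a equivariant M N).
Proof.
by apply: (iffP forall_inP) => h x Gx; apply/eqP; rewrite ?h // (eqP (h x Gx)).
Qed.

Lemma equivariant_zmod M N : zmod_closed (equivariant M N).
Proof.
split=> [|f g /equivariantP hf /equivariantP hg]; apply/equivariantP=> x Gx.
  by rewrite mulmx0 mul0mx.
by rewrite mulmxBr mulmxBl hf ?hg.
Qed.

HB.instance Definition _ M N :=
  GRing.isZmodClosed.Build _ (has_quality 1 (equivariant M N))
    (equivariant_zmod M N).

Record mhom M N := MHom {
  mhom_mx :> 'M[k]_(rdegree M, rdegree N);
  mhomP : mhom_mx \is a equivariant M N }.

HB.instance Definition _ M N := [isSub for @mhom_mx M N].
HB.instance Definition _ M N := [Choice of mhom M N by <:].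
HB.instance Definition _ M N := [SubChoice_isSubZmodule of mhom M N by <:].

Lemma mhomE M N (f : mhom M N) : {in G, forall x, M x *m f = f *m N x}.
Proof. exact/equivariantP/mhomP. Qed.

Lemma mhom_inj M N (f g : mhom M N) : mhom_mx f = mhom_mx g -> f = g.
Proof. exact: val_inj. Qed.

Fact mid_subproof M : 1%:M \is a equivariant M M.
Proof. by apply/equivariantP=> x Gx; rewrite mulmx1 mul1mx. Qed.
Definition mid M : mhom M M := MHom (mid_subproof M).

Fact mcomp_subproof M N P (g : mhom N P) (f : mhom M N) :
  f *m g \is a equivariant M P.
Proof. by apply/equivariantP=> x Gx; rewrite mulmxA mhomE // -!mulmxA mhomE. Qed.
Definition mcomp M N P (g : mhom N P) (f : mhom M N) : mhom M P :=
  MHom (mcomp_subproof g f).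

(* [row_full e] says that v |-> v *m e is surjective. *)
Definition projective P : Prop :=
  forall M N (e : mhom M N) (f : mhom P N), row_full e ->
  exists h : mhom P M, mcomp e h = f.

Definition via_projective M N (f : mhom M N) : bool :=
  `[< exists P (h : mhom P N) (g : mhom M P), projective P /\ f = mcomp h g >].

(* kG (x) M with the diagonal action. It is projective and injective, and M
   embeds in it by m |-> \sum_(g in G) g (x) m. *)
Definition free_tens M : kGmod := Representation (prod_repr (regular_repr k G) M).

Definition emb_mx M : 'M[k]_(rdegree M, rdegree (free_tens M)) :=
  trow (const_mx 1) 1%:M.

Lemma const_regular x : x \in G ->
  const_mx 1 *m regular_repr k G x = const_mx 1 :> 'rV_#|G|.
Proof.
move=> Gx; rewrite mulmx_sum_row; apply/rowP=> j; rewrite summxE !mxE.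
pose i := gring_index G (enum_val j * x^-1)%g.
have Gj : enum_val j \in G by apply: enum_valP.
rewrite (bigD1 i) //= big1 => [|i' ni']; rewrite !mxE eqxx /=.
  by rewrite gring_indexK ?groupM ?groupV // mulgKV gring_valK eqxx mulr1 addr0.
case: eqP => [ej|_]; last by rewrite mulr0.
case/eqP: ni'; rewrite /i ej gring_indexK ?groupM ?enum_valP //.
by rewrite mulgK gring_valK.
Qed.

Fact emb_subproof M : emb_mx M \is a equivariant M (free_tens M).
Proof.
apply/equivariantP=> x Gx; rewrite /emb_mx /= trow_tprod const_regular //.
by rewrite mul1mx -trow_mulr mulmx1.
Qed.
Definition emb M : mhom M (free_tens M) := MHom (emb_subproof M).

Lemma emb_free M : row_free (emb M).
Proof.
rewrite -kermx_eq0; apply/eqP; set K := kermx _.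
have := mulmx_ker (emb M); rewrite -/K /= /emb_mx -trow_mulr mulmx1.
apply: trow_eq0; apply/eqP=> /rowP/(_ (gring_index G 1%g)); rewrite !mxE.
by apply/eqP; rewrite oner_eq0.
Qed.

(* The trace map from k-linear to kG-linear maps. By Higman's criterion its image
   consists of the maps that factor through a projective module. *)
Definition rel_trace M N (phi : 'M[k]_(rdegree M, rdegree N)) :=
  \sum_(x in G) M x^-1%g *m phi *m N x.

Lemma rel_trace_subproof M N phi : @rel_trace M N phi \is a equivariant M N.
Proof.
apply/equivariantP=> y Gy; rewrite /rel_trace mulmx_sumr mulmx_suml.
rewrite (reindex_inj (mulIg y)) /=.
apply: eq_big => [x|x]; first by rewrite groupMr.
rewrite groupMr // => Gx; rewrite invMg !repr_mxM ?groupV //.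
by rewrite !mulmxA -repr_mxM ?groupV // mulgV repr_mx1 mul1mx.
Qed.

Lemma rel_trace_mulr M N P phi (h : mhom N P) : @rel_trace M N phi *m h = rel_trace (phi *m h).
Proof.
rewrite /rel_trace mulmx_suml; apply: eq_bigr => x Gx.
by rewrite -!mulmxA mhomE.
Qed.

Lemma rel_trace_mull M N P phi (h : mhom P M) :
  h *m @rel_trace M N phi = rel_trace (h *m phi).
Proof.
rewrite /rel_trace mulmx_sumr; apply: eq_bigr => x Gx.
by rewrite !mulmxA mhomE ?groupV.
Qed.

Definition trace_projective M := exists phi : 'M[k]_(rdegree M, rdegree M), rel_trace phi = 1%:M.

Lemma trace_projectiveP M : trace_projective M -> projective M.
Proof.
move=> [phi tr1] A B e f /row_fullP[s se].
exists (MHom (rel_trace_subproof (phi *m f *m s))); apply: mhom_inj => /=.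
rewrite rel_trace_mulr -mulmxA se mulmx1 -rel_trace_mulr tr1 mul1mx //.
Qed.

Lemma delta_regular x : x \in G ->
  regular_repr k G x^-1%g *m delta_mx (gring_index G 1%g) (gring_index G 1%g)
    *m regular_repr k G x = delta_mx (gring_index G x) (gring_index G x).
Proof.
move=> Gx; rewrite -(mul_delta_mx (0 : 'I_1)) mulmxA -mulmxA.
rewrite -[X in _ *m X]rowE rowK gring_indexK ?group1 // mul1g.
rewrite -[RHS](mul_delta_mx (0 : 'I_1)); congr (_ *m _).
rewrite -colE; apply/colP=> i; rewrite !mxE eqxx andbT /=; congr (_%:R).
have Gi := enum_valP i; congr nat_of_bool; apply/eqP/eqP => [e|->].
  have /(congr1 enum_val) := e; rewrite !gring_indexK ?groupM ?groupV //.
  by move=> h; rewrite -[LHS]gring_valK -[enum_val i](mulgKV x) -h mul1g.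
by rewrite gring_indexK // mulgV.
Qed.

Lemma free_tens_projective M : trace_projective (free_tens M).
Proof.
exists (tprod (delta_mx (gring_index G 1%g) (gring_index G 1%g)) 1%:M).
rewrite /rel_trace (eq_bigr (fun x => tprod (delta_mx (gring_index G x) (gring_index G x)) 1%:M)) => [|x Gx].
  rewrite -tprod_sum -[RHS]tprod1.
  suff -> : \sum_(x in G) delta_mx (gring_index G x) (gring_index G x) =
            1%:M :> 'M[k]_#|G| by [].
  rewrite mx1_sum_delta (reindex (enum_val : 'I_#|G| -> gT)) /=; last first.
    exists (gring_index G) => [i _|x Gx]; first by rewrite gring_valK.
    by rewrite gring_indexK.
  apply: eq_big => [i|i _]; first exact: enum_valP.
  by rewrite gring_valK.
rewrite /= -!tprodE delta_regular // mulmx1 -repr_mxM ?groupV //.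
by rewrite mulVg repr_mx1.
Qed.

Lemma rel_trace_emb M N phi : exists q : mhom (free_tens M) N, @rel_trace M N phi = emb M *m q.
Proof.
have /row_freeP[r er] := emb_free M.
exists (MHom (rel_trace_subproof (r *m phi))) => /=.
by rewrite (rel_trace_mull _ (emb M)) mulmxA er mul1mx.
Qed.

Lemma via_projP M N (f : mhom M N) :
  via_projective f <-> exists phi, mhom_mx f = rel_trace phi.
Proof.
split=> [/asboolP[P [h [g [prP ->]]]]|[phi fE]]; last first.
  have [q tq] := rel_trace_emb phi.
  apply/asboolP; exists (free_tens M), q, (emb M); split; last first.
    by apply: mhom_inj; rewrite fE tq.
  exact/trace_projectiveP/free_tens_projective.
suff [phi phi1] : trace_projective P.
  by exists (g *m (phi *m h)); rewrite -rel_trace_mull -rel_trace_mulr phi1 mul1mx.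
pose i1 := gring_index G 1%g.
pose r : 'M[k]_(rdegree P, rdegree (free_tens P)) := trow (delta_mx 0 i1) 1%:M.
have /row_freeP[s rs] : row_free r.
  rewrite -kermx_eq0; apply/eqP; have := mulmx_ker r; rewrite -trow_mulr mulmx1.
  apply: trow_eq0; apply/eqP=> /rowP/(_ i1); rewrite !mxE !eqxx.
  by apply/eqP; rewrite oner_eq0.
pose a : mhom (free_tens P) P := MHom (@rel_trace_subproof (free_tens P) P (tprod (delta_mx i1 i1) 1%:M *m s)).
have ra : r *m a = 1%:M.
  rewrite /= /rel_trace mulmx_sumr (bigD1 1%g) //= big1 => [|x /andP[Gx nx]].
    rewrite addr0 invg1 !repr_mx1 tprod1 mul1mx mulmx1 mulmxA trow_tprod.
    by rewrite mul_delta_mx mulmx1 -/r rs.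
  rewrite !mulmxA /= /r !trow_tprod -rowE rowK gring_indexK // mul1g.
  rewrite mul_delta_mx_cond.
  case: eqP => [/(congr1 enum_val)|_]; last first.
    by rewrite mulr0n -trowbE linear0 !mul0mx.
  rewrite !gring_indexK ?groupV // => /eqP; rewrite invg_eq1.
  by rewrite (negPf nx).
have [h1 ha] : exists h1 : mhom P (free_tens P), mcomp a h1 = mid P.
  by apply: prP; apply/row_fullP; exists r.
have {}ha : h1 *m a = 1%:M := congr1 (@mhom_mx _ _) ha.
have [psi psi1] := free_tens_projective P.
by exists (h1 *m (psi *m a)); rewrite -rel_trace_mull -rel_trace_mulr psi1 mul1mx ha.
Qed.

End Modules.

Section Stable.
Variables (k : fieldType) (gT : finGroupType) (G : {group gT}).
Local Notation kGmod := (representation k G).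
Implicit Types M N P : kGmod.

Lemma mhom_mxB M N (f g : mhom M N) : mhom_mx (f - g) = mhom_mx f - mhom_mx g.
Proof. by []. Qed.

Lemma mhom_mxD M N (f g : mhom M N) : mhom_mx (f + g) = mhom_mx f + mhom_mx g.
Proof. by []. Qed.

Lemma mcompE (A B C : kGmod) (g : mhom B C) (h : mhom A B) :
  mhom_mx (mcomp g h) = h *m g.
Proof. by []. Qed.

Fact via_projective_zmod M N : zmod_closed (@via_projective k gT G M N).
Proof.
have trB A B (p q : 'M[k]_(rdegree A, rdegree B)) :
    @rel_trace k gT G A B (p - q) = rel_trace p - rel_trace q.
  rewrite /rel_trace -sumrB; apply: eq_bigr => x _.
  by rewrite mulmxBr mulmxBl.
split=> [|f g /via_projP[p fp] /via_projP[q gq]]; apply/via_projP.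
  exists 0; rewrite /rel_trace big1 // => x _; by rewrite mulmx0 mul0mx.
by exists (p - q); rewrite trB -fp -gq.
Qed.

HB.instance Definition _ M N :=
  GRing.isZmodClosed.Build _ (@via_projective k gT G M N)
    (via_projective_zmod M N).

Local Notation stab_quot M N :=
  (Quotient.quot (GRing.ZmodClosed.clone (mhom M N) (@via_projective k gT G M N) _)).

(* The quotient of the group of kG-linear maps by those factoring through a
   projective module. *)
Definition stab_hom M N : zmodType := stab_quot M N.

Definition stab_pi M N (f : mhom M N) : stab_hom M N :=
  (\pi_(stab_quot M N) f)%qT.
Definition stab_repr M N (f : stab_hom M N) : mhom M N :=
  generic_quotient.repr (f : stab_quot M N).

Lemma stab_reprK M N (f : stab_hom M N) : stab_pi (stab_repr f) = f.
Proof. exact: reprK. Qed.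

Lemma stab_piD M N (f g : mhom M N) :
  stab_pi (f + g) = stab_pi f + stab_pi g.
Proof. exact: (raddfD (\pi_(stab_quot M N))%qT). Qed.

Lemma stab_pi_eq M N (f g : mhom M N) :
  stab_pi f = stab_pi g <-> via_projective (f - g).
Proof.
have E : via_projective (f - g) = (f == g %[mod stab_quot M N])%qT.
  exact: Quotient.idealrBE (GRing.ZmodClosed.clone (mhom M N) (@via_projective k gT G M N) _) f g.
split=> [h|h]; first by rewrite E; apply/eqP.
by apply/eqP; rewrite -E.
Qed.

Definition stab_comp M N P (g : stab_hom N P) (f : stab_hom M N) :
  stab_hom M P := stab_pi (mcomp (stab_repr g) (stab_repr f)).

Lemma stab_compE M N P (g : mhom N P) (f : mhom M N) :
  stab_comp (stab_pi g) (stab_pi f) = stab_pi (mcomp g f).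
Proof.
apply/stab_pi_eq/via_projP.
have /stab_pi_eq/via_projP[p pE] := stab_reprK (stab_pi f).
have /stab_pi_eq/via_projP[q qE] := stab_reprK (stab_pi g).
move: pE qE; set f' := stab_repr _; set g' := stab_repr _.
rewrite !mhom_mxB => pE qE.
exists (p *m g' + f *m q).
have trD (a b : 'M[k]_(rdegree M, rdegree P)) :
    @rel_trace k gT G M P (a + b) = rel_trace a + rel_trace b.
  rewrite /rel_trace -big_split; apply: eq_bigr => x _.
  by rewrite mulmxDr mulmxDl.
by rewrite trD -rel_trace_mulr -rel_trace_mull -pE -qE mulmxBl mulmxBr subrKA.
Qed.

Lemma stab_compA M N P Q (h : stab_hom P Q) (g : stab_hom N P)
    (f : stab_hom M N) :
  stab_comp h (stab_comp g f) = stab_comp (stab_comp h g) f.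
Proof.
rewrite -[h]stab_reprK -[g]stab_reprK -[f]stab_reprK !stab_compE.
by congr stab_pi; apply: mhom_inj; rewrite /= mulmxA.
Qed.

Lemma stab_comp1f M N (f : stab_hom M N) : stab_comp (stab_pi (mid N)) f = f.
Proof.
rewrite -[f]stab_reprK stab_compE.
by congr stab_pi; apply: mhom_inj; rewrite /= mulmx1.
Qed.

Lemma stab_compf1 M N (f : stab_hom M N) : stab_comp f (stab_pi (mid M)) = f.
Proof.
rewrite -[f]stab_reprK stab_compE.
by congr stab_pi; apply: mhom_inj; rewrite /= mul1mx.
Qed.

Section Coker.
Variables (A B : kGmod) (f : mhom A B).
Let U : 'M[k]_(rdegree B) := (<<mhom_mx f>>)%MS.

Fact coker_module : mxmodule B U.
Proof.
apply/mxmoduleP=> x Gx; rewrite (eqmxMr _ (genmxE _)) genmxE.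
by rewrite -mhomE // submxMl.
Qed.

Definition coker : kGmod := Representation (factmod_repr coker_module).

Fact coker_proj_subproof : in_factmod U 1%:M \is a equivariant B coker.
Proof.
apply/equivariantP=> x Gx; rewrite -in_factmodE /=.
by rewrite -[M in in_factmod _ M]mul1mx (in_factmodJ coker_module).
Qed.
Definition coker_proj : mhom B coker := MHom coker_proj_subproof.

Lemma coker_proj0 : f *m coker_proj = 0.
Proof.
apply/eqP; rewrite /= -in_factmodE in_factmod_eq0.
by rewrite genmxE.
Qed.

Definition coker_sec : 'M[k]_(rdegree coker, rdegree B) := val_factmod 1%:M.

Lemma coker_secK : coker_sec *m coker_proj = 1%:M.
Proof. by rewrite /= -in_factmodE val_factmodK. Qed.

Lemma coker_projK (n : nat) (d : 'M[k]_(rdegree B, n)) : f *m d = 0 ->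
  coker_proj *m (coker_sec *m d) = d.
Proof.
move=> fd0; rewrite mulmxA /= -val_factmodE.
rewrite -[X in _ = X]mul1mx -[X in _ = X *m _](add_sub_fact_mod U 1%:M) mulmxDl.
have /submxP[W ->] : (val_submod (in_submod U (1%:M : 'M_(rdegree B))) <= f)%MS.
  by rewrite (submx_trans (val_submodP _)) // genmxE.
by rewrite -mulmxA fd0 mulmx0 add0r.
Qed.

Lemma coker_epi (n : nat) (d d' : 'M[k]_(rdegree coker, n)) :
  coker_proj *m d = coker_proj *m d' -> d = d'.
Proof.
move/(congr1 (mulmx coker_sec)).
by rewrite !(mulmxA coker_sec coker_proj) coker_secK !mul1mx.
Qed.

(* The value 0 on the maps d that do not vanish on f is a dummy. *)
Fact coker_desc_subproof C (d : mhom B C) :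
  (if f *m d == 0 then coker_sec *m d else 0) \is a equivariant coker C.
Proof.
apply/equivariantP=> x Gx; case: eqP => [fd0|_]; last by rewrite mulmx0 mul0mx.
apply: coker_epi; rewrite (mulmxA coker_proj) -(mhomE coker_proj) // -mulmxA.
by rewrite !coker_projK // (mulmxA _ _ (C x)) coker_projK // mhomE.
Qed.
Definition coker_desc C (d : mhom B C) : mhom coker C :=
  MHom (coker_desc_subproof d).

Lemma coker_descP C (d : mhom B C) : f *m d = 0 ->
  coker_proj *m coker_desc d = d.
Proof. by move=> fd0; rewrite /= fd0 eqxx; exact: coker_projK. Qed.

End Coker.

(* The cosyzygy: 0 -> M -> kG (x) M -> stab_shift M -> 0 is exact, with an
   injective middle term. *)
Definition stab_shift M : kGmod := coker (emb M).

Fact free_tens_map_subproof M N (f : mhom M N) :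
  tprod 1%:M f \is a equivariant (free_tens M) (free_tens N).
Proof.
apply/equivariantP=> x Gx; rewrite /= -!tprodE mulmx1 mul1mx.
by rewrite mhomE.
Qed.
Definition free_tens_map M N (f : mhom M N) : mhom (free_tens M) (free_tens N) :=
  MHom (free_tens_map_subproof f).

Lemma emb_nat M N (f : mhom M N) : emb M *m free_tens_map f = f *m emb N.
Proof.
by rewrite /= /emb_mx trow_tprod mulmx1 mul1mx -trow_mulr mulmx1.
Qed.

Definition shift_map M N (f : mhom M N) : mhom (stab_shift M) (stab_shift N) :=
  coker_desc (emb M) (mcomp (coker_proj (emb N)) (free_tens_map f)).

Lemma shift_mapP M N (f : mhom M N) :
  coker_proj (emb M) *m shift_map f = free_tens_map f *m coker_proj (emb N).
Proof.
rewrite coker_descP // mcompE (mulmxA (emb M)) emb_nat.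
by rewrite -(mulmxA f) coker_proj0 mulmx0.
Qed.

Definition stab_shiftm M N (f : stab_hom M N) :
  stab_hom (stab_shift M) (stab_shift N) := stab_pi (shift_map (stab_repr f)).

Lemma via_projective_free M N P (h : mhom (free_tens P) N) (g : mhom M (free_tens P)) :
  via_projective (mcomp h g).
Proof.
apply/asboolP; exists (free_tens P), h, g; split => //.
exact/trace_projectiveP/free_tens_projective.
Qed.

Lemma emb_desc0 M N (d : 'M_(rdegree (free_tens M), rdegree N)) :
  mhom_mx (emb M) *m d = 0 -> d = coker_proj (emb M) *m (coker_sec (emb M) *m d).
Proof. by move/coker_projK. Qed.

Lemma stab_shiftE M N (f : mhom M N) :
  stab_shiftm (stab_pi f) = stab_pi (shift_map f).
Proof.
apply/stab_pi_eq.
have /stab_pi_eq/via_projP[p] := stab_reprK (stab_pi f).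
have [q ->] := rel_trace_emb p.
set f' := stab_repr _; rewrite mhom_mxB => qE.
pose c : mhom (free_tens M) (free_tens N) := free_tens_map f' - free_tens_map f - mcomp (emb N) q.
have c0 : emb M *m c = 0.
  rewrite !mhom_mxB 2!mulmxBr !emb_nat -mulmxBl qE mulmxA.
  by rewrite subrr.
suff -> : shift_map f' - shift_map f =
    mcomp (coker_proj (emb N)) (coker_desc (emb M) c).
  exact: via_projective_free.
apply: mhom_inj; apply: (coker_epi (f := emb M)); rewrite mhom_mxB mulmxBr !shift_mapP.
rewrite mcompE (mulmxA (coker_proj _)) coker_descP //.
rewrite /c !mhom_mxB mcompE 2!mulmxBl -(mulmxA q) coker_proj0 mulmx0 subr0.
by [].
Qed.

Fact cone_in_subproof M N (f : mhom M N) :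
  row_mx f (- mhom_mx (emb M)) \is a equivariant M (dadd_grepr N (free_tens M)).
Proof.
apply/equivariantP=> x Gx; rewrite /= mul_mx_row mul_row_block !mulmx0 add0r addr0.
rewrite mulmxN mulNmx; have /= -> := mhomE (emb M) Gx.
by rewrite (mhomE f Gx).
Qed.
Definition cone_in M N (f : mhom M N) : mhom M (dadd_grepr N (free_tens M)) :=
  MHom (cone_in_subproof f).

(* The pushout of f : M -> N along M -> kG (x) M. *)
Definition cone M N (f : mhom M N) : kGmod := coker (cone_in f).

Fact dadd_inl_subproof M N : row_mx 1%:M 0 \is a equivariant M (dadd_grepr M N).
Proof.
apply/equivariantP=> x Gx; rewrite /= mul_mx_row mul_row_block !mulmx0 !mul0mx.
by rewrite mulmx1 mul1mx !addr0.
Qed.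
Definition dadd_inl M N : mhom M (dadd_grepr M N) := MHom (dadd_inl_subproof M N).

Fact dadd_desc_subproof M N P (f : mhom M P) (g : mhom N P) :
  col_mx f g \is a equivariant (dadd_grepr M N) P.
Proof.
apply/equivariantP=> x Gx; rewrite /= mul_block_col mul_col_mx !mul0mx.
by rewrite addr0 add0r !mhomE.
Qed.
Definition dadd_desc M N P (f : mhom M P) (g : mhom N P) :
  mhom (dadd_grepr M N) P := MHom (dadd_desc_subproof f g).

Definition cone_inl M N (f : mhom M N) : mhom N (cone f) :=
  mcomp (coker_proj (cone_in f)) (dadd_inl N (free_tens M)).

Definition cone_out M N (f : mhom M N) : mhom (cone f) (stab_shift M) :=
  coker_desc (cone_in f) (dadd_desc (0 : mhom N _) (coker_proj (emb M))).

Definition stab_iso M N (a : stab_hom M N) : Prop :=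
  exists b : stab_hom N M,
    stab_comp b a = stab_pi (mid M) /\ stab_comp a b = stab_pi (mid N).

(* The triangles isomorphic in the stable category to a standard triangle
   M -> N -> cone f -> stab_shift M. *)
Definition stab_triangle A B C (u : stab_hom A B) (v : stab_hom B C)
    (w : stab_hom C (stab_shift A)) : Prop :=
  exists M N (f : mhom M N)
         (a : stab_hom M A) (b : stab_hom N B) (c : stab_hom (cone f) C),
  [/\ stab_iso a, stab_iso b & stab_iso c] /\
  [/\ stab_comp u a = stab_comp b (stab_pi f),
      stab_comp v b = stab_comp c (stab_pi (cone_inl f)) &
      stab_comp w c = stab_comp (stab_shiftm a) (stab_pi (cone_out f))].

Fact triv_mx_repr : mx_repr G (fun _ => 1%:M : 'M[k]_1).
Proof. by split=> // x y _ _; rewrite mulmx1. Qed.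
Definition triv_rep : kGmod := Representation (MxRepresentation triv_mx_repr).

End Stable.

Definition stab (k : fieldType) (gT : finGroupType) (G : {group gT}) : ttCat :=
  {| tt_ob := representation k G;
     tt_hom := @stab_hom k gT G;
     tt_id := fun M => stab_pi (mid M);
     tt_comp := @stab_comp k gT G;
     tt_shift := @stab_shift k gT G;
     tt_shiftm := @stab_shiftm k gT G;
     tt_triangle := @stab_triangle k gT G;
     tt_tensor := fun M N => Representation (prod_repr M N);
     tt_unit := triv_rep k G |}.

Section Restriction.
Variables (k : fieldType) (gT : finGroupType) (G H : {group gT}).
Hypothesis sHG : H \subset G.
Implicit Types M N : representation k G.

Definition res M : representation k H := Representation (subg_repr M sHG).

Fact mres_subproof M N (f : mhom M N) : mhom_mx f \is a equivariant (res M) (res N).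
Proof. by apply/equivariantP=> x /(fintype.subsetP sHG) Gx; exact: (mhomE f Gx). Qed.
Definition mres M N (f : mhom M N) : mhom (res M) (res N) :=
  MHom (mres_subproof f).

Lemma res_tr M N (phi : 'M[k]_(rdegree M, rdegree N)) :
  exists psi, rel_trace (M := M) (N := N) phi = rel_trace (M := res M) (N := res N) psi.
Proof.
pose r x := fingroup.repr (x *: H)%g.
exists (\sum_(t in G | r t == t) M t^-1%g *m phi *m N t).
rewrite {2}/rel_trace; under eq_bigr => h Hh do rewrite mulmx_sumr mulmx_suml.
rewrite exchange_big /rel_trace /=.
have rP x : exists2 h, h \in H & x = (r x * h)%g.
  have /lcosetP[h Hh rE] : r x \in (x *: H)%g by apply: (mem_repr x); rewrite mem_lcoset mulVg group1.
  exists h^-1%g; rewrite ?groupV //.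
  by rewrite rE mulgK.
have rG x : x \in G -> r x \in G.
  move=> Gx; have [h Hh xE] := rP x.
  by rewrite -(groupMr _ (fintype.subsetP sHG h Hh)) -xE.
have rH t h : h \in H -> r (t * h)%g = r t.
  by move=> Hh; rewrite /r lcosetM lcoset_id.
have rr x : r (r x) = r x.
  by have [h Hh xE] := rP x; rewrite {2}xE rH.
clearbody r; rewrite (partition_big r (fun t => (t \in G) && (r t == t))) /=; last first.
  by move=> x Gx; rewrite rG // rr eqxx.
apply: eq_bigr => t /andP[Gt /eqP rt].
rewrite (reindex_inj (mulgI t)) /=; apply: eq_big => [h|h].
  apply/andP/idP => [[Gth /eqP rth]|Hh].
    have [h' Hh'] := rP (t * h)%g.
    by rewrite rth => /mulgI->.
    by split; [rewrite groupM // (fintype.subsetP sHG)|rewrite rH ?rt].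
case/andP=> Gth _; have Gh : h \in G by rewrite -(groupMl _ Gt).
by rewrite invMg !repr_mxM ?groupV // !mulmxA.
Qed.

Lemma res_via_projective M N (f : mhom M N) :
  via_projective f -> via_projective (mres f).
Proof.
move=> /via_projP[phi fE]; apply/via_projP.
by have [psi psiE] := res_tr phi; exists psi; rewrite -psiE.
Qed.

Lemma res_trace_projective M : trace_projective M -> trace_projective (res M).
Proof.
by move=> [phi phi1]; have [psi psiE] := res_tr phi; exists psi; rewrite -psiE.
Qed.

Definition stab_res_mor M N (f : stab_hom M N) : stab_hom (res M) (res N) :=
  stab_pi (mres (stab_repr f)).

Lemma stab_resE M N (f : mhom M N) :
  stab_res_mor (stab_pi f) = stab_pi (mres f).
Proof.
apply/stab_pi_eq; have /stab_pi_eq/res_via_projective := stab_reprK (stab_pi f).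
by congr (is_true (via_projective _)); apply: mhom_inj.
Qed.

Lemma stab_resD M N (f g : stab_hom M N) :
  stab_res_mor (f + g) = stab_res_mor f + stab_res_mor g.
Proof.
rewrite -[f]stab_reprK -[g]stab_reprK -stab_piD !stab_resE -stab_piD.
by congr stab_pi; apply: mhom_inj.
Qed.

Lemma stab_res1 M : stab_res_mor (stab_pi (mid M)) = stab_pi (mid (res M)).
Proof. by rewrite stab_resE; congr stab_pi; apply: mhom_inj. Qed.

Lemma stab_resM A B C (g : stab_hom B C) (f : stab_hom A B) :
  stab_res_mor (stab_comp g f) = stab_comp (stab_res_mor g) (stab_res_mor f).
Proof.
rewrite -[f]stab_reprK -[g]stab_reprK stab_compE !stab_resE stab_compE.
by congr stab_pi; apply: mhom_inj.
Qed.

Lemma stab_res_iso M N (a : stab_hom M N) :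
  stab_iso a -> stab_iso (stab_res_mor a).
Proof.
by move=> [b [ba ab]]; exists (stab_res_mor b); rewrite -!stab_resM ba ab !stab_res1.
Qed.

Lemma stab_iso_comp (L : {group gT}) (A B C : representation k L)
  (g : stab_hom B C) (f : stab_hom A B) :
  stab_iso g -> stab_iso f -> stab_iso (stab_comp g f).
Proof.
move=> [g' [g'g gg']] [f' [f'f ff']]; exists (stab_comp f' g'); split.
  by rewrite stab_compA -(stab_compA f') g'g stab_compf1.
by rewrite stab_compA -(stab_compA g) ff' stab_compf1.
Qed.

Lemma via_projective_tr (L : {group gT}) (A B C : representation k L)
  (h : mhom B C) (g : mhom A B) : trace_projective B -> via_projective (mcomp h g).
Proof.
move=> trB; apply/asboolP; exists B, h, g; split => //.
exact: trace_projectiveP.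
Qed.

Section ResCoker.
Variables (A B : representation k G) (f : mhom A B).

Fact res_desc_subproof (C : representation k H) (d : mhom (res B) C) :
  (if f *m d == 0 then coker_sec f *m d else 0)
    \is a equivariant (res (coker f)) C.
Proof.
apply/equivariantP=> x Hx; have Gx := fintype.subsetP sHG x Hx.
case: eqP => [fd0|_]; last by rewrite mulmx0 mul0mx.
apply: (coker_epi (f := f)).
rewrite (mulmxA (coker_proj f)) -(mhomE (coker_proj f)) // -mulmxA.
by rewrite !coker_projK // (mulmxA _ _ (C x)) coker_projK // (mhomE d).
Qed.
Definition res_desc (C : representation k H) (d : mhom (res B) C) :
  mhom (res (coker f)) C := MHom (res_desc_subproof d).

Lemma res_descP (C : representation k H) (d : mhom (res B) C) :
  f *m d = 0 -> coker_proj f *m res_desc d = d.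
Proof. by move=> fd0; rewrite /= fd0 eqxx; exact: coker_projK. Qed.
End ResCoker.

Definition regular_restr : 'M[k]_(#|G|, #|H|) :=
  \matrix_(i, j) (enum_val i == enum_val j)%:R.

Lemma row_regular_restr (x : gT) : x \in G ->
  row (gring_index G x) regular_restr =
    if x \in H then delta_mx 0 (gring_index H x) else 0.
Proof.
move=> Gx; apply/rowP=> j; rewrite !mxE gring_indexK //.
case: ifP => Hx; rewrite !mxE ?eqxx /=; last first.
  by case: eqP => // xE; case/negP: (negbT Hx); rewrite xE; apply: enum_valP.
congr (nat_of_bool _)%:R; apply/eqP/eqP => [->|->]; first by rewrite gring_valK.
by rewrite gring_indexK.
Qed.

Lemma regular_restrE x : x \in H ->
  regular_repr k G x *m regular_restr = regular_restr *m regular_repr k H x.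
Proof.
move=> Hx; have Gx := fintype.subsetP sHG x Hx; apply/row_matrixP=> i.
have Gi : enum_val i \in G by apply: enum_valP.
rewrite !row_mul rowK -rowE row_regular_restr; last by rewrite groupM.
rewrite groupMr //.
rewrite -[i in row i regular_restr]gring_valK row_regular_restr //.
case: ifP => Hi; last by rewrite mul0mx.
by rewrite -rowE rowK gring_indexK.
Qed.

Lemma const_regular_restr : const_mx 1 *m regular_restr = const_mx 1 :> 'rV_#|H|.
Proof.
apply/rowP=> j; rewrite !mxE; have Hj : enum_val j \in H by apply: enum_valP.
have Gj := fintype.subsetP sHG _ Hj.
rewrite (bigD1 (gring_index G (enum_val j))) //= !mxE gring_indexK //.
rewrite eqxx mulr1 big1 ?addr0 // => i ni; rewrite !mxE.
case: eqP => [ij|_]; last by rewrite mulr0.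
by rewrite -ij gring_valK eqxx in ni.
Qed.

(* The H-linear map kG (x) M -> kH (x) M that kills g (x) m for g \notin H. *)
Fact free_tens_res_subproof M : tprod regular_restr 1%:M \is a equivariant (res (free_tens M)) (free_tens (res M)).
Proof.
by apply/equivariantP=> x Hx; rewrite /= -!tprodE mulmx1 mul1mx regular_restrE.
Qed.
Definition free_tens_res M : mhom (res (free_tens M)) (free_tens (res M)) := MHom (free_tens_res_subproof M).

Lemma emb_free_tens_res M : emb M *m free_tens_res M = emb (res M).
Proof. by rewrite /= /emb_mx trow_tprod const_regular_restr mulmx1. Qed.

Lemma free_tens_res_nat M N (f : mhom M N) :
  free_tens_map f *m free_tens_res N = free_tens_res M *m free_tens_map (mres f).
Proof. by rewrite /= -!tprodE !mulmx1 !mul1mx. Qed.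

Fact free_tens_res_ker M :
  emb M *m mcomp (coker_proj (emb (res M))) (free_tens_res M) = 0.
Proof.
rewrite mcompE (mulmxA (emb M)) emb_free_tens_res.
exact: (coker_proj0 (emb (res M))).
Qed.

Definition res_shift0 M : mhom (res (stab_shift M)) (stab_shift (res M)) :=
  res_desc (emb M) (mcomp (coker_proj (emb (res M))) (free_tens_res M)).

Lemma res_shift0P M :
  coker_proj (emb M) *m res_shift0 M = free_tens_res M *m coker_proj (emb (res M)).
Proof. by rewrite /res_shift0 res_descP // free_tens_res_ker. Qed.

Definition res_shift M : stab_hom (res (stab_shift M)) (stab_shift (res M)) :=
  stab_pi (res_shift0 M).

Lemma res_shift_nat M N (f : stab_hom M N) :
  stab_comp (res_shift N) (stab_res_mor (stab_shiftm f)) =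
  stab_comp (stab_shiftm (stab_res_mor f)) (res_shift M).
Proof.
rewrite -[f]stab_reprK stab_shiftE !stab_resE stab_shiftE !stab_compE.
move: (stab_repr f) => {}f; congr stab_pi; apply: mhom_inj.
apply: (coker_epi (f := emb M)); rewrite 2!mcompE.
rewrite 2!(mulmxA (coker_proj _)) shift_mapP res_shift0P.
rewrite -(mulmxA (free_tens_map f)) res_shift0P (mulmxA (free_tens_map f)) free_tens_res_nat.
by rewrite -2!(mulmxA (free_tens_res M)) shift_mapP.
Qed.

Lemma free_tens_res_inv M : exists eta : mhom (free_tens (res M)) (res (free_tens M)),
  emb (res M) *m eta = emb M.
Proof.
have [phi tr1] := res_trace_projective (free_tens_projective M).
have [q qE] := rel_trace_emb (M := res M) (N := res (free_tens M)) (emb M *m phi).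
exists q; rewrite -qE -(rel_trace_mull _ (mres (emb M))) tr1 mulmx1.
by [].
Qed.

Section Cones.
Variables (M N : representation k G) (f : mhom M N).
Variable eta : mhom (free_tens (res M)) (res (free_tens M)).
Hypothesis etaP : emb (res M) *m eta = emb M.

Lemma eta_l : exists d : mhom (res (stab_shift M)) (res (free_tens M)),
  free_tens_res M *m eta = 1%:M + coker_proj (emb M) *m d.
Proof.
pose c := mcomp eta (free_tens_res M) - mres (mid (free_tens M)).
exists (res_desc (emb M) c).
have c0 : emb M *m c = 0.
  rewrite mhom_mxB mcompE mulmxBr (mulmxA (emb M)) emb_free_tens_res etaP mulmx1.
  by rewrite subrr.
by rewrite res_descP // addrC mhom_mxB subrK.
Qed.

Lemma eta_r : exists d : mhom (stab_shift (res M)) (free_tens (res M)),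
  eta *m free_tens_res M = 1%:M + coker_proj (emb (res M)) *m d.
Proof.
pose c := mcomp (free_tens_res M) eta - mid (free_tens (res M)).
exists (coker_desc (emb (res M)) c).
have c0 : emb (res M) *m c = 0.
  rewrite mhom_mxB mcompE mulmxBr (mulmxA (emb (res M))) etaP emb_free_tens_res mulmx1.
  by rewrite subrr.
by rewrite coker_descP // addrC mhom_mxB subrK.
Qed.

Lemma res_shift_iso_eta : stab_iso (res_shift M).
Proof.
pose b : mhom (stab_shift (res M)) (res (stab_shift M)) :=
  coker_desc (emb (res M)) (mcomp (mres (coker_proj (emb M))) eta).
have bP : coker_proj (emb (res M)) *m b = eta *m coker_proj (emb M).
  rewrite coker_descP // mcompE (mulmxA (emb (res M))) etaP.
  exact: (coker_proj0 (emb M)).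
exists (stab_pi b); rewrite !stab_compE; split; apply/stab_pi_eq.
- have [d dE] := eta_l.
  suff -> : mcomp b (res_shift0 M) - mid (res (stab_shift M)) =
      mcomp (mres (coker_proj (emb M))) d.
    exact/via_projective_tr/res_trace_projective/free_tens_projective.
  apply: mhom_inj; apply: (coker_epi (f := emb M)).
  rewrite mhom_mxB 2!mcompE mulmxBr mulmx1 2!(mulmxA (coker_proj _)) res_shift0P.
  rewrite -(mulmxA (free_tens_res M)) bP (mulmxA (free_tens_res M)) dE mulmxDl mul1mx.
  by rewrite addrAC subrr add0r.
- have [d dE] := eta_r.
  suff -> : mcomp (res_shift0 M) b - mid (stab_shift (res M)) =
      mcomp (coker_proj (emb (res M))) d.
    exact: via_projective_free.
  apply: mhom_inj; apply: (coker_epi (f := emb (res M))).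
  rewrite mhom_mxB 2!mcompE mulmxBr mulmx1 2!(mulmxA (coker_proj _)) bP.
  rewrite -(mulmxA eta) res_shift0P (mulmxA eta) dE mulmxDl mul1mx.
  by rewrite addrAC subrr add0r.
Qed.

Let Cf := cone f.
Let Ch := cone (mres f).

Definition blk m n p (X : 'M[k]_(n, p)) : 'M_(m + n, m + p) := block_mx 1%:M 0 0 X.

Fact blk_res_subproof :
  blk (rdegree N) (free_tens_res M)
    \is a equivariant (res (dadd_grepr N (free_tens M))) (dadd_grepr (res N) (free_tens (res M))).
Proof.
apply/equivariantP=> x Hx; rewrite /blk /= !mulmx_block.
rewrite !mulmx0 !mul0mx !addr0 !add0r mulmx1 mul1mx.
by have /= -> := mhomE (free_tens_res M) Hx.
Qed.
Definition blk_res : mhom (res (dadd_grepr N (free_tens M))) (dadd_grepr (res N) (free_tens (res M)))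
  := MHom blk_res_subproof.

Fact blk_eta_subproof :
  blk (rdegree N) eta
    \is a equivariant (dadd_grepr (res N) (free_tens (res M))) (res (dadd_grepr N (free_tens M))).
Proof.
apply/equivariantP=> x Hx; rewrite /blk /= !mulmx_block.
rewrite !mulmx0 !mul0mx !addr0 !add0r mulmx1 mul1mx.
by have /= -> := mhomE eta Hx.
Qed.
Definition blk_eta : mhom (dadd_grepr (res N) (free_tens (res M))) (res (dadd_grepr N (free_tens M)))
  := MHom blk_eta_subproof.

Lemma cone_in_blk_res : cone_in f *m blk_res = cone_in (mres f).
Proof.
rewrite /= mul_row_block !mulmx0 addr0 add0r mulmx1 mulNmx.
by have /= -> := emb_free_tens_res M.
Qed.

Lemma cone_in_blk_eta : cone_in (mres f) *m blk_eta = cone_in f.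
Proof.
rewrite /= mul_row_block !mulmx0 addr0 add0r mulmx1 mulNmx.
by have /= -> := etaP.
Qed.

Definition cone_cmp : mhom (res Cf) Ch :=
  res_desc (cone_in f) (mcomp (coker_proj (cone_in (mres f))) blk_res).
Definition cone_cmp' : mhom Ch (res Cf) :=
  coker_desc (cone_in (mres f)) (mcomp (mres (coker_proj (cone_in f))) blk_eta).

Lemma cone_cmpP : coker_proj (cone_in f) *m cone_cmp =
  blk_res *m coker_proj (cone_in (mres f)).
Proof.
rewrite /cone_cmp res_descP // mcompE (mulmxA (cone_in f)) cone_in_blk_res.
exact: (coker_proj0 (cone_in (mres f))).
Qed.

Lemma cone_cmp'P : coker_proj (cone_in (mres f)) *m cone_cmp' =
  blk_eta *m coker_proj (cone_in f).
Proof.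
rewrite /cone_cmp' coker_descP // mcompE (mulmxA (cone_in (mres f))) cone_in_blk_eta.
exact: (coker_proj0 (cone_in f)).
Qed.

Lemma cone_outP (L : {group gT}) (A B : representation k L) (g : mhom A B) :
  coker_proj (cone_in g) *m cone_out g = col_mx 0 (coker_proj (emb A)).
Proof.
rewrite coker_descP //= mul_row_col mulmx0 add0r mulNmx.
by have /= -> := coker_proj0 (emb A); rewrite oppr0.
Qed.

Fact dadd_inr_subproof (L : {group gT}) (A B : representation k L) :
  row_mx 0 1%:M \is a equivariant B (dadd_grepr A B).
Proof.
apply/equivariantP=> x Gx; rewrite /= mul_mx_row mul_row_block !mulmx0 !mul0mx.
by rewrite mulmx1 mul1mx !add0r.
Qed.
Definition dadd_inr (L : {group gT}) (A B : representation k L) :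
  mhom B (dadd_grepr A B) := MHom (dadd_inr_subproof A B).

Lemma blk_split m n p q (X : 'M[k]_(n, p)) (D : 'M[k]_(q, n))
    (E : 'M[k]_(n, q)) (F : 'M_(p, n)) :
  X *m F = 1%:M + E *m D ->
  blk m X *m blk m F = 1%:M + col_mx 0 E *m (D *m row_mx 0 1%:M).
Proof.
move=> XF; rewrite /blk mulmx_block !mulmx0 !mul0mx !addr0 !add0r mulmx1 XF.
rewrite mulmxA mul_col_mx mul0mx mul_col_mx mul0mx mul_mx_row mulmx0 mulmx1.
rewrite -[X in col_mx X _]row_mx0 -block_mxEv scalar_mx_block add_block_mx.
by rewrite !addr0.
Qed.

Lemma cone_cmpK : stab_pi (mcomp cone_cmp' cone_cmp) = stab_pi (mid (res Cf)).
Proof.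
have [d dE] := eta_l; apply/stab_pi_eq.
suff -> : mcomp cone_cmp' cone_cmp - mid (res Cf) =
    mcomp (mcomp (mres (mcomp (coker_proj (cone_in f)) (dadd_inr N (free_tens M)))) d)
          (mres (cone_out f)).
  have -> : forall (A B C D : representation k H) (a : mhom C D) (b : mhom B C)
    (c : mhom A B), mcomp (mcomp a b) c = mcomp a (mcomp b c).
    by move=> *; apply: mhom_inj; rewrite /= mulmxA.
  exact/via_projective_tr/res_trace_projective/free_tens_projective.
apply: mhom_inj; apply: (coker_epi (f := cone_in f)).
rewrite mhom_mxB !mcompE mulmxBr mulmx1 2!(mulmxA (coker_proj _)) cone_cmpP cone_outP.
rewrite -(mulmxA blk_res) cone_cmp'P (mulmxA blk_res).
rewrite [X in X *m _](blk_split _ dE) mulmxDl mul1mx addrAC subrr add0r.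
by rewrite !mulmxA.
Qed.

Lemma cone_cmp'K : stab_pi (mcomp cone_cmp cone_cmp') = stab_pi (mid Ch).
Proof.
have [d dE] := eta_r; apply/stab_pi_eq.
suff -> : mcomp cone_cmp cone_cmp' - mid Ch =
    mcomp (mcomp (mcomp (coker_proj (cone_in (mres f)))
                        (dadd_inr (res N) (free_tens (res M)))) d)
          (cone_out (mres f)).
  have -> : forall (A B C D : representation k H) (a : mhom C D) (b : mhom B C)
    (c : mhom A B), mcomp (mcomp a b) c = mcomp a (mcomp b c).
    by move=> *; apply: mhom_inj; rewrite /= mulmxA.
  exact: via_projective_free.
apply: mhom_inj; apply: (coker_epi (f := cone_in (mres f))).
rewrite mhom_mxB !mcompE mulmxBr mulmx1 2!(mulmxA (coker_proj _)) cone_cmp'P cone_outP.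
rewrite -(mulmxA blk_eta) cone_cmpP (mulmxA blk_eta).
rewrite [X in X *m _](blk_split _ dE) mulmxDl mul1mx addrAC subrr add0r.
by rewrite !mulmxA.
Qed.

Lemma cone_cmp'_inl : mcomp cone_cmp' (cone_inl (mres f)) = mres (cone_inl f).
Proof.
apply: mhom_inj; rewrite !mcompE -(mulmxA (dadd_inl _ _)) cone_cmp'P.
rewrite (mulmxA (dadd_inl _ _)); congr (_ *m _).
by rewrite /= /blk mul_row_block !mulmx0 !mul0mx mul1mx !addr0.
Qed.

Lemma cone_cmp_out :
  mcomp (cone_out (mres f)) cone_cmp = mcomp (res_shift0 M) (mres (cone_out f)).
Proof.
apply: mhom_inj; apply: (coker_epi (f := cone_in f)); rewrite 2!mcompE.
rewrite 2!(mulmxA (coker_proj _)) cone_cmpP -(mulmxA blk_res) !cone_outP.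
rewrite [RHS]mul_col_mx mul0mx res_shift0P.
by rewrite /= /blk mul_block_col !mulmx0 !mul0mx !add0r.
Qed.

End Cones.

Lemma res_shift_iso M : stab_iso (res_shift M).
Proof. by have [eta /res_shift_iso_eta] := free_tens_res_inv M. Qed.

Lemma res_triangle (A B C : representation k G) (u : stab_hom A B)
    (v : stab_hom B C) (w : stab_hom C (stab_shift A)) :
  stab_triangle u v w ->
  stab_triangle (stab_res_mor u) (stab_res_mor v)
    (stab_comp (res_shift A) (stab_res_mor w)).
Proof.
move=> [M [N [f [a [b [c [[ia ib ic] [ua vb wc]]]]]]]].
have [eta etaP] := free_tens_res_inv M.
have kk := cone_cmpK f etaP; have kk' := cone_cmp'K f etaP.
rewrite -stab_compE in kk; rewrite -stab_compE in kk'.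
exists (res M), (res N), (mres f), (stab_res_mor a), (stab_res_mor b).
exists (stab_comp (stab_res_mor c) (stab_pi (cone_cmp' f eta))).
split; split.
- exact: stab_res_iso.
- exact: stab_res_iso.
- apply: stab_iso_comp; first exact: stab_res_iso.
  by exists (stab_pi (cone_cmp f)).
- by rewrite -stab_resM ua stab_resM stab_resE.
- rewrite -stab_resM vb stab_resM stab_resE -stab_compA stab_compE.
  by rewrite cone_cmp'_inl.
- rewrite stab_compA -(stab_compA (res_shift A)) -stab_resM wc stab_resM.
  rewrite (stab_compA (res_shift A)) res_shift_nat stab_resE -2!stab_compA.
  have -> : stab_comp (res_shift M) (stab_comp (stab_pi (mres (cone_out f)))
      (stab_pi (cone_cmp' f eta))) = stab_pi (cone_out (mres f)); last by [].
  rewrite stab_compA (stab_compE (res_shift0 M) (mres (cone_out f))) -cone_cmp_out -stab_compE -stab_compA kk'.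
  exact: stab_compf1.
Qed.

Definition stab_res : exact_functor (stab k G) (stab k H) :=
  @ExactFunctor (stab k G) (stab k H) res (@stab_res_mor) stab_resD stab_res1
    stab_resM res_shift res_shift_iso res_shift_nat res_triangle.

End Restriction.

Arguments stab k {gT} G.
Arguments stab_res k {gT G H} sHG.

(* Main.v *)
Require Import Defs.
From mathcomp Require Import all_boot all_order all_algebra.
From mathcomp Require Import all_fingroup all_character.
From Stdlib Require List.
From mathcomp Require Import pgroup cyclic finmap ring mxtens.
From mathcomp Require Import boolp classical_sets cardinality constructive_ereal.
From mathcomp Require Import topology.

Set Implicit Arguments.
Unset Strict Implicit.
Unset Printing Implicit Defensive.

Import Order.TTheory GRing.Theory Num.Theory.

(** Let [Spc_res] be the map P |-> Res^-1(P) from Spc(kH-stab) to Spc(kG-stab).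
    A prime P lies in supp (Res A) exactly when [Spc_res P] lies in supp A, so
    the theorem is a statement about this map.

    Dimensions do not increase ([dim_shift_res]). The closure of a point P of a
    spectrum is the set of the primes contained in P ([closure_SpcP]), and every
    irreducible closed set has a generic point ([generic_pointP]). Chains of
    irreducible closed sets are thus chains of primes, and a chain that ends in
    a point of supp (Res A) is mapped to a chain that ends in a point of supp A.
    The image has the same length because two nested primes of kH-stab with the
    same image are equal ([Spc_res_incomparable]). The proof of this imitates
    the incomparability theorem for an integral ring extension, in which an
    element is a root of a monic polynomial over the base ring. Let X be a
    representation of H, and let e_j(X) be the direct sum, over the j-element
    subsets J of the coset space H\G, of the tensor product over J of the
    conjugates of X; this is the part of degree j of the tensor induction of
    k (+) X, and it is a representation of G. Let f_j(X) be the sum of the terms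
    for which J does not contain the coset H, a representation of H. Sorting the
    subsets according to whether they contain H gives
        Res e_(j+1) = f_(j+1) (+) (f_j (x) X),
    and f_j = 0 for j >= |G : H|. Let P be contained in Q, let Res^-1(Q) be
    contained in Res^-1(P), and let X be in Q but not in P. If f_(j+1) is in P,
    then Res e_(j+1) is in Q, hence in P, hence so is its summand f_j (x) X, and
    f_j is in P because P is prime. By descending induction f_0, which is the
    unit object, is in P, and this is absurd.

    No negative integer will do ([dim_shift_res_ge0]). Let C be a subgroup of H
    of order p, and K = k[G/C]. It suffices that supp K has dimension at most 0
    and that supp (Res K) is not empty. The main tool is a trace criterion: a
    kC-module all of whose endomorphisms have trace 0 is projective
    ([trace_zero_projective]), and conversely. As the trace is multiplicative on
    tensor products, the projective kC-modules form a prime ideal of kC-stab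
    ([projectives_prime]). Its preimage in kH-stab lies in supp (Res K), because
    the projection onto the basis vector of the fixed coset C is a kC-linear
    endomorphism of K of trace 1. Let P be a prime of kG-stab that does not
    contain K. If X is projective over C, then K (x) X is projective
    ([trace_perm_tens]), so X is in P. If X is not projective over C, then it
    has a kC-endomorphism of nonzero trace; this splits K off (K (x) X^* ) (x) X
    ([prime_perm_trace]), so X is not in P. Therefore P is the preimage of
    the zero ideal of kC-stab, and supp K has at most one point. *)

(** * Dimension as a supremum over chains *)

Section Supremum.
Local Open Scope ring_scope.
Local Open Scope classical_set_scope.

(** The defining choice of [supremum] is meaningful only when a supremum exists;
    a set of integers that is bounded above has a largest element. *)
Lemma eint_supremums (A : set (\bar int)) : supremums A !=set0.
Proof.
have [Apoo|Apoo] := pselect (A +oo%E).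
  by exists +oo%E; split=> [x _|y /(_ _ Apoo)]; rewrite ?leey.
have [[z Az]|Afin] := pselect (exists z : int, A z%:E); last first.
  exists -oo%E; split=> [[z|//|//] Az|y _]; last by rewrite leNye.
  by case: Afin; exists z.
have [[b bA]|unb] := pselect (exists b : int, ubound A b%:E); last first.
  exists +oo%E; split=> [x _|[y|//|] yA]; first by rewrite leey.
    by case: unb; exists y.
  by have := yA _ Az; rewrite leeNy_eq.
(* The least upper bound is at least z, so it is z + m for the least natural
   number m such that z + m is an upper bound. *)
have zb : z <= b by have := bA _ Az; rewrite lee_fin.
have [n bn] : exists n : nat, b = z + n%:Z.
  by exists `|b - z|%N; rewrite gez0_abs ?subr_ge0 // addrCA subrr addr0.
pose P n := `[< ubound A (z + n%:Z)%:E >].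
have exP : exists n, P n by exists n; apply/asboolP; rewrite -bn.
case: (ex_minnP exP) => m /asboolP ubm min_m.
exists (z + m%:Z)%:E; split=> // -[y|_|/(_ _ Az)]; last 2 first.
- by rewrite leey.
- by rewrite leeNy_eq.
move=> yA; have zy : z <= y by have := yA _ Az; rewrite lee_fin.
have yE : y = z + `|y - z|%N%:Z by rewrite gez0_abs ?subr_ge0 // addrCA subrr addr0.
by rewrite lee_fin yE lerD2l lez_nat min_m //; apply/asboolP; rewrite -yE.
Qed.

Lemma supremum_leP (A : set (\bar int)) (y : \bar int) :
  (supremum -oo%E A <= y)%E <-> forall a, A a -> (a <= y)%E.
Proof.
rewrite /supremum; case: eqP => [->|_].
  by split=> // _; rewrite leNye.
have [s As] := eint_supremums A.
case: xgetP => [t -> [At tA]|/(_ s)//].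
by split=> [ty a /At /le_trans|h]; [apply|apply: tA => a /h].
Qed.

Lemma set_dim_leP (T : topologicalType) (V : set T) (l : int) :
  (set_dim V <= l%:E)%E <->
  forall x n C, V x -> irreducible_chain n C -> C n = closure [set x] ->
    n%:Z <= l.
Proof.
split=> [/supremum_leP h x n C Vx Ch Cx|h].
  have /supremum_leP kx := h _ (imageP _ Vx).
  rewrite -lee_fin; apply: kx; exists n => //.
  by exists C.
apply/supremum_leP => _ [x Vx <-]; apply/supremum_leP => _ [n [C Ch Cx] <-].
by rewrite lee_fin (h x n C).
Qed.
End Supremum.

(** * The topology of the spectrum *)

Section SpcTopology.
Local Open Scope ring_scope.
Local Open Scope classical_set_scope.
Variable K : ttCat.
Implicit Types (P Q R : Spc K) (A B : K).

Lemma Spc_open_supp A : open (~` supp A : set (Spc K)).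
Proof.
exists [set ~` supp A] => [_ ->|]; last by rewrite bigcup_set1.
exists [fset (~` supp A : set (Spc K))]%fset.
  by move=> U /fset1P ->; rewrite inE; exists A.
by rewrite set_fset1 bigcap_set1.
Qed.

Lemma closed_supp A : closed (supp A : set (Spc K)).
Proof. by rewrite -[supp A]setCK; apply/open_closedC/Spc_open_supp. Qed.

(** Basic neighbourhoods of P are finite intersections of complements of supports,
    so a neighbourhood is controlled by finitely many objects of P. *)
Lemma nbhs_SpcP P (U : set (Spc K)) : nbhs P U ->
  exists2 s : seq K, List.Forall (Spc_set P) s &
    forall R, List.Forall (Spc_set R) s -> U R.
Proof.
rewrite nbhsE => -[V [[F sF VE] VP] VU].
move: VP; rewrite -VE => -[W FW WP].
have [D sD WE] := sF _ FW.
have [s sP sW] : exists2 s : seq K, List.Forall (Spc_set P) s &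
    forall R, List.Forall (Spc_set R) s -> forall X, X \in (D : seq _) -> X R.
  have {}WP X : X \in D -> X P by move=> XD; move: WP; rewrite -WE; apply.
  have {}sD : {subset (D : seq _) <= [set ~` supp A | A in [set: K]]} by exact: sD.
  have {WP} : forall X, X \in (D : seq _) -> X P by exact: WP.
  elim: (D : seq _) sD => [|X E IH] sE EP; first by exists [::].
  have [|s sP sE'] := IH (fun Y YE => sE Y (mem_behead (s := X :: E) YE)).
    by move=> Y YE; apply: EP; rewrite inE YE orbT.
  have := sE X (mem_head _ _); rewrite inE => -[A _ XA].
  have XP := EP X (mem_head _ _); exists (A :: s).
    constructor=> //; move: XP; rewrite -XA => /contrapT //.
  move=> R Rs Y; inversion Rs; subst; rewrite inE => /orP[/eqP ->|]; last exact: sE'.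
  by move=> /=; apply.
exists s => // R Rs; apply: VU; rewrite -VE; exists W => //.
have : (\bigcap_(X in [set` D]) X) R by move=> X /= XD; apply: sW XD.
by move: WE => /= ->.
Qed.

(** The order is opposite to the one for prime ideals of a commutative ring,
    because the sets supp A consist of the primes that avoid A. *)
Lemma closure_SpcP P Q :
  closure [set P] Q <-> (Q : set K) `<=` (P : set K).
Proof.
split=> [PQ A QA|sQP U /nbhs_SpcP[s sQ sU]].
  apply: contrapT => PA.
  have : closure (supp A) Q by apply: closure_subset PQ => _ ->.
  by rewrite -(closure_id _).1; [apply | exact: closed_supp].
exists P; split=> //; apply: sU.
by apply: List.Forall_impl sQ => A; apply: sQP.
Qed.

Lemma closure_Spc_irr P : irreducible_set (closure [set P]).
Proof.
have PP : closure [set P] P by exact/closure_SpcP.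
split=> [|F1 F2 F1c F2c sF]; first by exists P.
have cl (F : set (Spc K)) : closed F -> F P -> closure [set P] `<=` F.
  by move=> /closure_id FE FP; rewrite {}FE; apply: closure_subset => _ ->.
by case: (sF P PP) => [/cl|/cl] h; [left|right]; apply: h.
Qed.

Section Generic.
Variable e : K.
Hypothesis eP : forall P, ~ (P : set K) e.
Variable C : set (Spc K).
Hypotheses (clC : closed C) (irrC : irreducible_set C).

(** The union of the primes in C: the only candidate for the generic point of C,
    by [closure_SpcP]. *)
Definition generic_ideal : set K := [set A | exists2 P, C P & (P : set K) A].

(** Irreducibility makes the union of the primes in C directed enough to be closed
    under cones: otherwise C would be covered by supp A and supp B. *)
Lemma generic_common A B : generic_ideal A -> generic_ideal B ->
  exists P, [/\ C P, (P : set K) A & (P : set K) B].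
Proof.
move=> [P CP PA] [Q CQ QB]; apply: contrapT => noR.
have [] := irrC.2 _ _ (@closed_supp A) (@closed_supp B).
- move=> R CR; apply: contrapT => /not_orP[/contrapT RA /contrapT RB].
  by apply: noR; exists R.
- by move=> /(_ P CP); apply.
- by move=> /(_ _ CQ); apply.
Qed.

Lemma generic_ideal_prime : prime_ideal generic_ideal.
Proof.
split.
- split.
  + move=> A A0; have [P CP] := irrC.1; exists P => //.
    exact: thick_zero (prime_thick (Spc_prime P)) _ A0.
  + move=> A B f fi [P CP PA]; exists P => //.
    exact: thick_iso (prime_thick (Spc_prime P)) _ _ f fi PA.
  + move=> A; split=> -[P CP PA]; exists P => //;
    exact/(thick_shift (prime_thick (Spc_prime P))).
  + move=> A B D u v w T.
    split=> gA gB; have [P [CP PA PB]] := generic_common gA gB;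
    have [h1 h2 h3] := thick_triangle (prime_thick (Spc_prime P)) T;
    exists P => //; [exact: h1|exact: h2|exact: h3].
  + move=> A B S AB [P CP PS].
    by have [] := thick_summand (prime_thick (Spc_prime P)) AB PS; split; exists P.
- move=> gT; have : generic_ideal e by rewrite gT.
  by move=> [P _ /eP].
- by move=> A B [P CP PB]; exists P => //; apply: (prime_tensor (Spc_prime P)).
- move=> A B [P CP PAB].
  by have [] := prime_prime (Spc_prime P) PAB; [left|right]; exists P.
Qed.

(** The union of the primes in C is a prime, proper because the object e, for
    which one takes the unit, lies in no prime. Every basic neighbourhood of it
    meets C by irreducibility, so it is in C. *)
Lemma generic_pointP : exists P : Spc K, C = closure [set P].
Proof.
exists (MkSpc generic_ideal_prime); rewrite eqEsubset; split=> [Q CQ|Q].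
  by apply/closure_SpcP => A QA; exists Q.
suff CG : C (MkSpc generic_ideal_prime).
  rewrite [X in _ -> X Q](closure_id _).1 //.
  by apply: closure_subset => _ ->.
rewrite [C](closure_id _).1 // => U /nbhs_SpcP[s sG sU].
suff [P CP Ps] : exists2 P, C P & List.Forall (Spc_set P) s.
  by exists P; split => //; apply: sU.
have {sU} : List.Forall generic_ideal s := sG.
(* Neighbourhoods are given by finitely many objects, irreducibility by pairs. *)
pose Us (s : seq K) : set (Spc K) := [set P | ~ List.Forall (Spc_set P) s].
have cUs t : closed (Us t).
  elim: t => [|A t IH].
    suff -> : Us [::] = set0 by exact: closed0.
    by rewrite -subset0 => P; apply; constructor.
  suff -> : Us (A :: t) = supp A `|` Us t by apply: closedU => //; exact: closed_supp.
  rewrite eqEsubset; split=> P /=.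
    move=> h; apply: contrapT => /not_orP[/contrapT a /contrapT b].
    by apply: h; constructor.
  by move=> h h'; inversion h'; subst; case: h.
elim: s {sG} => [_|A s IH gAs]; first by have [P CP] := irrC.1; exists P.
inversion gAs as [|A' s' gA gs]; subst.
apply: contrapT => noP; have [Q0 CQ Qs] := IH gs; have [R CR RA] := gA.
have [] := irrC.2 _ _ (@closed_supp A) (cUs s).
- move=> T CT; apply: contrapT => /not_orP[/contrapT TA /contrapT Ts].
  by apply: noP; exists T => //; constructor.
- by move=> /(_ R CR); apply.
- by move=> /(_ _ CQ); apply.
Qed.
End Generic.

End SpcTopology.

(** * Direct sums and retracts in the stable category *)

Section StableThick.
Local Open Scope ring_scope.
Local Open Scope classical_set_scope.
Variables (k : fieldType) (gT : finGroupType) (G : {group gT}).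
Local Notation kGmod := (representation k G).
Implicit Types A B M N : kGmod.

Lemma stab_pi0 M N : stab_pi (0 : mhom M N) = 0.
Proof. by apply: (addrI (stab_pi (0 : mhom M N))); rewrite -stab_piD !addr0. Qed.

Lemma stab_iso_id M : stab_iso (stab_pi (mid M)).
Proof. by exists (stab_pi (mid M)); rewrite stab_comp1f. Qed.

(** Biproducts are checked on matrices, where composition is the product in the
    reverse order. *)
Lemma mhom_biproduct A B S (i1 : mhom A S) (i2 : mhom B S)
    (p1 : mhom S A) (p2 : mhom S B) :
  i1 *m p1 = 1%:M -> i2 *m p2 = 1%:M -> i1 *m p2 = 0 -> i2 *m p1 = 0 ->
  p1 *m i1 + p2 *m i2 = 1%:M ->
  @is_biproduct (stab k G) A B S.
Proof.
move=> e11 e22 e12 e21 eS.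
exists (stab_pi i1), (stab_pi i2), (stab_pi p1), (stab_pi p2).
rewrite /= !stab_compE -stab_piD -!stab_pi0.
by split; congr stab_pi; apply: mhom_inj; rewrite ?mhom_mxD.
Qed.

Lemma stab_shift_id M : stab_shiftm (stab_pi (mid M)) = stab_pi (mid (stab_shift M)).
Proof.
rewrite stab_shiftE; congr stab_pi; apply: mhom_inj.
apply: (coker_epi (f := emb M)).
by rewrite shift_mapP /= tprod1 mul1mx mulmx1.
Qed.

(** The cone of a split monomorphism i1 : A -> S is stably the complement B: it
    is the quotient of S (+) kG (x) A by A, and kG (x) A is projective. *)
Lemma thick_sum (P : set (stab k G)) A B S (i1 : mhom A S) (i2 : mhom B S)
    (p1 : mhom S A) (p2 : mhom S B) :
  thick_subcategory P ->
  i1 *m p1 = 1%:M -> i2 *m p2 = 1%:M -> i1 *m p2 = 0 ->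
  p1 *m i1 + p2 *m i2 = 1%:M ->
  P A -> P B -> P S.
Proof.
move=> tP e11 e22 e12 eS PA PB.
pose c := coker_desc (cone_in i1) (dadd_desc p2 (0 : mhom (free_tens A) B)).
have cP : coker_proj (cone_in i1) *m c = col_mx p2 0.
  by rewrite coker_descP //= mul_row_col mulmx0 addr0 e12.
pose d := mcomp (cone_inl i1) i2.
have dP : mhom_mx d = i2 *m (row_mx 1%:M 0 *m coker_proj (cone_in i1)) by [].
have cd : stab_comp (stab_pi c) (stab_pi d) = stab_pi (mid B).
  rewrite stab_compE; congr stab_pi; apply: mhom_inj.
  rewrite mcompE dP -(mulmxA i2) -(mulmxA (row_mx _ _)) cP.
  by rewrite mul_row_col mul1mx mul0mx addr0 e22.
have dc : stab_comp (stab_pi d) (stab_pi c) = stab_pi (mid (cone i1)).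
  rewrite stab_compE; apply/stab_pi_eq.
  (* On (s, a) in S (+) kG (x) A the map d c - 1 takes, modulo the relations
     (i1 v, - emb v), the value (0, - emb (p1 s) - a). It factors through u. *)
  pose u : mhom (dadd_grepr S (free_tens A)) (free_tens A) :=
    dadd_desc (- mcomp (emb A) p1) (- mid _).
  have u0 : cone_in i1 *m u = 0.
    rewrite /= mul_row_col mulmxN mulmxA e11 mul1mx mulNmx mulmxN mulmx1.
    by rewrite opprK addNr.
  pose v := mcomp (coker_proj (cone_in i1)) (dadd_inr S (free_tens A)).
  suff -> : mcomp d c - mid (cone i1) = mcomp v (coker_desc (cone_in i1) u).
    exact: via_projective_free.
  apply: mhom_inj; apply: (coker_epi (f := cone_in i1)).
  rewrite mhom_mxB mcompE (mcompE _ (coker_desc _ u)) mulmxBr mulmx1.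
  rewrite (mulmxA (coker_proj _) c) cP dP.
  rewrite (mulmxA (coker_proj _) (coker_desc _ u)) coker_descP //.
  rewrite (mcompE (coker_proj _)).
  have := coker_proj0 (cone_in i1); move: (mhom_mx (coker_proj _)) => cp cp0.
  apply/eqP; rewrite -subr_eq0 -[X in _ - X - _]mul1mx !mulmxA -!mulmxBl; apply/eqP.
  have -> : col_mx p2 0 *m i2 *m row_mx 1%:M 0 - 1%:M - u *m dadd_inr S (free_tens A)
            = col_mx (- mhom_mx p1) 0 *m cone_in i1.
    rewrite /= mul_col_mx !mul_col_row !mul0mx !mulmx0 !mulmx1 scalar_mx_block.
    rewrite !opp_block_mx !add_block_mx mulmxN mulNmx opprK !oppr0 !addr0 !add0r.
    by rewrite opprK addNr -eS opprD addrCA subrr addr0 mulNmx opprK.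
  by rewrite -mulmxA cp0 mulmx0.
have T : @tt_triangle (stab k G) A S B (stab_pi i1) (stab_pi p2)
    (stab_comp (stab_pi (cone_out i1)) (stab_pi d)).
  exists A, S, i1, (stab_pi (mid A)), (stab_pi (mid S)), (stab_pi c).
  split; first by split; [exact: stab_iso_id | exact: stab_iso_id | exists (stab_pi d)].
  split.
  - by rewrite stab_compf1 stab_comp1f.
  - rewrite stab_compf1 stab_compE; congr stab_pi; apply: mhom_inj.
    by rewrite mcompE -(mulmxA (dadd_inl _ _)) cP mul_row_col mul1mx mul0mx addr0.
  - by rewrite -stab_compA dc stab_compf1 stab_shift_id stab_comp1f.
by have [_ _ h] := thick_triangle tP T; apply: h.
Qed.

(** For r a retraction of f, the map 1 - r f vanishes on A, and the map it induces
    on the cokernel is a section. *)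
Lemma split_coker A B (f : mhom A B) (r : mhom B A) : f *m r = 1%:M ->
  exists s : mhom (coker f) B,
    [/\ s *m coker_proj f = 1%:M, s *m r = 0 &
        r *m f + coker_proj f *m s = 1%:M].
Proof.
move=> fr; pose q := mid B - mcomp f r.
have fq : f *m q = 0.
  by rewrite mhom_mxB mcompE mulmxBr mulmx1 mulmxA fr mul1mx subrr.
have sP : coker_proj f *m coker_desc f q = q by rewrite coker_descP.
exists (coker_desc f q); split.
- apply: (coker_epi (f := f)); rewrite mulmxA sP mulmx1.
  rewrite mhom_mxB mcompE mulmxBl mul1mx -mulmxA.
  by rewrite (coker_proj0 f) mulmx0 subr0.
- apply: (coker_epi (f := f)); rewrite mulmxA sP mulmx0.
  by rewrite mhom_mxB mcompE mulmxBl mul1mx -mulmxA fr mulmx1 subrr.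
- by rewrite sP mhom_mxB mcompE addrC subrK.
Qed.

(** Thickness is stated for direct summands with a given complement; the cokernel
    of the section provides one. *)
Lemma thick_retract (P : set (stab k G)) A S (i : mhom A S) (r : mhom S A) :
  thick_subcategory P -> i *m r = 1%:M -> P S -> P A.
Proof.
move=> tP ir PS; have [s [sp sr e]] := split_coker ir.
have AB : is_biproduct (K := stab k G) A (coker i) S.
  exact: (mhom_biproduct ir sp (coker_proj0 i) sr e).
by have [] := thick_summand tP AB PS.
Qed.
End StableThick.

(** * Matrices indexed by finite types *)

Section Frames.
Local Open Scope ring_scope.
Variable k : fieldType.

(** A numbering of the finite type B. Matrices of size n can then be described by
    coefficients indexed by B, which for tensor products and for tensor induction
    are much easier to handle than the numbers of the basis vectors. *)
Record frame (n : nat) (B : finType) := Frame {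
  fval : 'I_n -> B;
  fidx : B -> 'I_n;
  fvalK : cancel fval fidx;
  fidxK : cancel fidx fval }.

Definition ord_frame n : frame n 'I_n :=
  @Frame n 'I_n id id (fun _ => erefl) (fun _ => erefl).

Definition enum_frame (B : finType) : frame #|B| B :=
  @Frame #|B| B enum_val enum_rank (@enum_valK B) (@enum_rankK B).

Section Pair.
Variables (m n : nat) (A B : finType) (e : frame m A) (f : frame n B).
Definition pair_val (i : 'I_(m * n)) : A * B :=
  let: (a, b) := mxtens_unindex i in (fval e a, fval f b).
Definition pair_idx (ab : A * B) : 'I_(m * n) :=
  mxtens_index (fidx e ab.1, fidx f ab.2).
Fact pair_valK : cancel pair_val pair_idx.
Proof.
move=> i; rewrite /pair_val /pair_idx -[RHS]mxtens_unindexK.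
by case: (mxtens_unindex i) => a b /=; rewrite !fvalK.
Qed.
Fact pair_idxK : cancel pair_idx pair_val.
Proof. by case=> a b; rewrite /pair_val /pair_idx mxtens_indexK /= !fidxK. Qed.
Definition pair_frame : frame (m * n)%N (A * B)%type := Frame pair_valK pair_idxK.
End Pair.

Section Entries.
Variables (m n : nat) (A B : finType) (e : frame m A) (f : frame n B).

Definition entry (M : 'M[k]_(m, n)) a b := M (fidx e a) (fidx f b).
Definition mxf (F : A -> B -> k) : 'M[k]_(m, n) :=
  \matrix_(i, j) F (fval e i) (fval f j).

Lemma mxfE F a b : entry (mxf F) a b = F a b.
Proof. by rewrite /entry mxE !fidxK. Qed.

Lemma entry_inj (M N : 'M[k]_(m, n)) :
  (forall a b, entry M a b = entry N a b) -> M = N.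
Proof.
by move=> h; apply/matrixP=> i j; rewrite -[i](fvalK e) -[j](fvalK f); apply: h.
Qed.
End Entries.

Lemma entryM (m n p : nat) (A B C : finType) (e : frame m A) (f : frame n B)
    (g : frame p C) (M : 'M[k]_(m, n)) (N : 'M_(n, p)) a c :
  entry e g (M *m N) a c = \sum_b entry e f M a b * entry f g N b c.
Proof.
rewrite /entry mxE (reindex (fidx f)) //.
by exists (fval f) => x _; rewrite ?fvalK ?fidxK.
Qed.

Lemma entry1 (m : nat) (A : finType) (e : frame m A) a b :
  entry e e 1%:M a b = (a == b)%:R.
Proof. by rewrite /entry mxE (can_eq (fidxK e)). Qed.

Lemma entryD (m n : nat) (A B : finType) (e : frame m A) (f : frame n B)
  (M N : 'M[k]_(m, n)) a b :
  entry e f (M + N) a b = entry e f M a b + entry e f N a b.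
Proof. by rewrite /entry mxE. Qed.

Lemma mxtrace_entry (m : nat) (A : finType) (e : frame m A) (M : 'M[k]_m) :
  \tr M = \sum_a entry e e M a a.
Proof.
rewrite /mxtrace (reindex (fidx e)) //.
by exists (fval e) => x _; rewrite ?fvalK ?fidxK.
Qed.

Lemma mxtens_index0 m n (j : 'I_n) :
  mxtens_index (ord0 : 'I_m.+1, j) = lshift (m * n) j.
Proof. exact: val_inj. Qed.

Lemma mxtens_indexS m n (i : 'I_m) (j : 'I_n) :
  mxtens_index (rshift 1 i : 'I_m.+1, j) = rshift n (mxtens_index (i, j)).
Proof. by apply: val_inj; rewrite /= mulSn addnA. Qed.

Lemma trow_index q (a : 'rV[k]_q) m n (B : 'M_(m, n)) i j1 j2 :
  trow a B i (mxtens_index (j1, j2)) = a 0 j1 * B i j2.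
Proof.
elim: q a j1 => [|q IH] a j1; first by case: j1.
have [j ->|j ->] := @split_ordP 1 q j1.
  rewrite [j]ord1 (_ : lshift q 0 = ord0) ?mxtens_index0; last exact: val_inj.
  by rewrite /= row_mxEl !mxE; congr (a _ _ * _); apply: val_inj.
by rewrite mxtens_indexS /= row_mxEr IH !mxE.
Qed.

(** The product [tprod] is defined by recursion on blocks; it turns out to be the
    Kronecker product for the lexicographic numbering of pairs. *)
Lemma tprod_index m1 n1 m2 n2 (A : 'M[k]_(m1, n1)) (B : 'M[k]_(m2, n2))
    i1 i2 j1 j2 :
  tprod A B (mxtens_index (i1, i2)) (mxtens_index (j1, j2)) = A i1 j1 * B i2 j2.
Proof.
elim: m1 A i1 => [|m1 IH] A i1; first by case: i1.
have [i ->|i ->] := @split_ordP 1 m1 i1.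
  rewrite [i]ord1 (_ : lshift m1 0 = ord0) ?mxtens_index0; last exact: val_inj.
  rewrite /= col_mxEu trow_index !mxE; congr (A _ _ * _); exact: val_inj.
by rewrite mxtens_indexS /= col_mxEd IH !mxE.
Qed.

Lemma tprod_entry (m1 n1 m2 n2 : nat) (A1 B1 A2 B2 : finType)
   (e1 : frame m1 A1) (f1 : frame n1 B1) (e2 : frame m2 A2) (f2 : frame n2 B2)
   (M : 'M_(m1, n1)) (N : 'M_(m2, n2)) a b :
  entry (pair_frame e1 e2) (pair_frame f1 f2) (tprod M N) a b =
  entry e1 f1 M a.1 b.1 * entry e2 f2 N a.2 b.2.
Proof. exact: tprod_index. Qed.
End Frames.

(** * Representations with a finite basis *)

Section KroneckerSums.
Local Open Scope ring_scope.
Variables (k : fieldType) (I : finType).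

Lemma sum_delta (i : I) (F : I -> k) :
  \sum_j (i == j)%:R * F j = F i.
Proof.
rewrite (bigD1 i) //= eqxx mul1r big1 ?addr0 // => j /negPf ji.
by rewrite eq_sym ji mul0r.
Qed.

Lemma sum_deltar (i : I) (F : I -> k) :
  \sum_j F j * (j == i)%:R = F i.
Proof.
rewrite -[RHS](sum_delta i); apply: eq_bigr => j _.
by rewrite mulrC eq_sym.
Qed.

End KroneckerSums.

Section BasisRep.
Local Open Scope ring_scope.
Variables (k : fieldType) (gT : finGroupType) (G : {group gT}) (B : finType).
Variable rho : gT -> B -> B -> k.
Hypothesis rho1 : forall a b, rho 1%g a b = (a == b)%:R.
Hypothesis rhoM : {in G &, forall x y a c,
  rho (x * y)%g a c = \sum_b rho x a b * rho y b c}.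

Let e := enum_frame B.

Fact basis_rep_subproof : mx_repr G (fun x => mxf e e (rho x)).
Proof.
split=> [|x y Gx Gy]; apply: (entry_inj (e := e) (f := e)) => a b.
  by rewrite mxfE rho1 entry1.
rewrite (entryM _ e) mxfE rhoM //.
by apply: eq_bigr => c _; rewrite !mxfE.
Qed.

(** The representation with basis B in which x acts on row vectors by the matrix
    of coefficients rho x. *)
Definition basis_rep : representation k G :=
  Representation (MxRepresentation basis_rep_subproof).

Lemma basis_repE x a b : entry e e (basis_rep x) a b = rho x a b.
Proof. exact: mxfE. Qed.
End BasisRep.

Section BasisMaps.
Local Open Scope ring_scope.
Variables (k : fieldType) (gT : finGroupType) (G : {group gT}).
Implicit Types M N S : representation k G.

Lemma mxf_equivariant M N (A B : finType) (e : frame (rdegree M) A)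
    (f : frame (rdegree N) B) (F : A -> B -> k) :
  {in G, forall x a c, \sum_b entry e e (M x) a b * F b c =
     \sum_b F a b * entry f f (N x) b c} ->
  mxf e f F \is a equivariant M N.
Proof.
move=> h; apply/equivariantP => x Gx.
apply: (entry_inj (e := e) (f := f)) => a c.
rewrite (entryM _ e) (entryM _ f).
under eq_bigr do rewrite mxfE; rewrite h //.
by under [RHS]eq_bigr do rewrite mxfE.
Qed.

(** The injection s identifies the basis of M with part of the basis of S, and
    the matrices of S are block diagonal for this part and its complement. The
    two equations say that the inclusion and the projection are equivariant. *)
Definition basis_summand M S (A B : finType) (e : frame (rdegree M) A)
    (f : frame (rdegree S) B) (s : A -> B) :=
  injective s /\ {in G, forall x a b,
  [/\ entry f f (S x) (s a) b = \sum_a' entry e e (M x) a a' * (s a' == b)%:R &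
      entry f f (S x) b (s a) = \sum_a' (b == s a')%:R * entry e e (M x) a' a]}.

Lemma basis_summandP M S (A B : finType) (e : frame (rdegree M) A)
    (f : frame (rdegree S) B) (s : A -> B) :
  injective s ->
  {in G, forall x a a', entry f f (S x) (s a) (s a') = entry e e (M x) a a'} ->
  {in G, forall x a b, b \notin codom s ->
     entry f f (S x) (s a) b = 0 /\ entry f f (S x) b (s a) = 0} ->
  basis_summand e f s.
Proof.
move=> si sS s0; split=> // x Gx a b.
have [/codomP[a' ->]|nb] := boolP (b \in codom s).
  rewrite !sS //; split.
    under eq_bigr do rewrite (inj_eq si); rewrite sum_deltar //.
  by under eq_bigr do rewrite (inj_eq si); rewrite sum_delta.
have [-> ->] := s0 x Gx a b nb.
split; rewrite big1 // => a' _.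
  case: eqP => [sb|]; last by rewrite mulr0.
  by case/negP: nb; rewrite -sb codom_f.
case: eqP => [sb|]; last by rewrite mul0r.
by case/negP: nb; rewrite sb codom_f.
Qed.

Section Inc.
Variables (M S : representation k G) (A B : finType) (e : frame (rdegree M) A)
    (f : frame (rdegree S) B) (s : A -> B) (hs : basis_summand e f s).

Fact basis_inc_subproof : mxf e f (fun a b => (s a == b)%:R) \is a equivariant M S.
Proof.
apply: mxf_equivariant => x Gx a b.
by rewrite sum_delta; have [-> _] := hs.2 x Gx a b.
Qed.
Definition basis_inc : mhom M S := MHom basis_inc_subproof.

Fact basis_proj_subproof : mxf f e (fun b a => (b == s a)%:R) \is a equivariant S M.
Proof.
apply: mxf_equivariant => x Gx b a.
by rewrite sum_deltar; have [_ ->] := hs.2 x Gx a b.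
Qed.
Definition basis_proj : mhom S M := MHom basis_proj_subproof.

Lemma basis_incK : basis_inc *m basis_proj = 1%:M.
Proof.
apply: (entry_inj (e := e) (f := e)) => a a'.
rewrite (entryM _ f) entry1 -(inj_eq hs.1) -(sum_delta (s a) (fun b => (b == s a')%:R)).
by apply: eq_bigr => b _; rewrite !mxfE.
Qed.

Lemma basis_proj_inc b b' :
  entry f f (basis_proj *m basis_inc) b b' = (b \in codom s)%:R * (b == b')%:R.
Proof.
rewrite (entryM _ e).
under eq_bigr do rewrite !mxfE.
have [/codomP[a ->]|nb] := boolP (b \in codom s).
  under eq_bigr do rewrite (inj_eq hs.1).
  by rewrite sum_delta mul1r.
rewrite mul0r big1 // => a _; case: eqP => [sb|]; last by rewrite mul0r.
by case/negP: nb; rewrite sb codom_f.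
Qed.
End Inc.

Local Open Scope classical_set_scope.

Lemma thick_basis_retract (P : set (stab k G)) M S (A B : finType)
    (e : frame (rdegree M) A) (f : frame (rdegree S) B) (s : A -> B) :
  basis_summand e f s -> thick_subcategory P -> P S -> P M.
Proof. by move=> hs tP; apply: thick_retract tP (basis_incK hs). Qed.

Lemma thick_basis_sum (P : set (stab k G)) M N S (A B C : finType)
    (e : frame (rdegree M) A) (f : frame (rdegree N) B) (g : frame (rdegree S) C)
    (s : A -> C) (t : B -> C) :
  basis_summand e g s -> basis_summand f g t ->
  (forall c, (c \in codom t) = (c \notin codom s)) ->
  thick_subcategory P -> P M -> P N -> P S.
Proof.
move=> hs ht st tP PM PN.
apply: (thick_sum (i1 := basis_inc hs) (i2 := basis_inc ht)
  (p1 := basis_proj hs) (p2 := basis_proj ht)) => //.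
- exact: basis_incK.
- exact: basis_incK.
- apply: (entry_inj (e := e) (f := f)) => a b.
  rewrite (entryM _ g) [RHS]mxE.
  under eq_bigr do rewrite !mxfE.
  rewrite (sum_delta (s a) (fun c => (c == t b)%:R)); case: eqP => // sa.
  by have := st (t b); rewrite codom_f -sa codom_f.
- apply: (entry_inj (e := g) (f := g)) => c c'.
  rewrite entryD !basis_proj_inc st entry1 -mulrDl.
  by case: (_ \in codom s); rewrite /= ?addr0 ?add0r mul1r.
Qed.

End BasisMaps.

(** * Tensor products and the unit *)

Section Tensor.
Local Open Scope ring_scope.
Local Open Scope classical_set_scope.
Variables (k : fieldType) (gT : finGroupType) (G : {group gT}).
Implicit Types (M N : representation k G) (P : set (stab k G)).

Definition tens M N : representation k G := Representation (prod_repr M N).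

Definition tframe M N (A B : finType) (e : frame (rdegree M) A)
  (f : frame (rdegree N) B) : frame (rdegree (tens M N)) (A * B)%type :=
  pair_frame e f.

Lemma tens_entry M N (A B : finType) (e : frame (rdegree M) A)
  (f : frame (rdegree N) B) x ab cd :
  entry (tframe e f) (tframe e f) (tens M N x) ab cd =
  entry e e (M x) ab.1 cd.1 * entry f f (N x) ab.2 cd.2.
Proof. exact: tprod_entry. Qed.

(** M is isomorphic to M (x) k. *)
Lemma thick_tens_unit P M : thick_subcategory P ->
  P (tens M (triv_rep k G)) -> P M.
Proof.
pose e := ord_frame (rdegree M); pose o := ord_frame (rdegree (triv_rep k G)).
apply: (thick_basis_retract (e := e) (f := tframe e o) (s := fun a => (a, 0 : 'I_1))).
apply: basis_summandP => [a b [//]|x Gx a a'|x Gx a [b j]].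
  by rewrite tens_entry /= [X in _ * X]entry1 eqxx mulr1.
by rewrite [j]ord1 => /codomP[]; exists b.
Qed.

(** Representations given by the same matrices need not be equal, as they contain
    proofs; they are isomorphic. *)
Lemma thick_eq_repr P n (r1 r2 : mx_representation k G n) :
  {in G, r1 =1 r2} -> thick_subcategory P ->
  P (Representation r1) -> P (Representation r2).
Proof.
move=> r12; have hs : basis_summand (M := Representation r2)
    (S := Representation r1) (ord_frame n) (ord_frame n) id.
  apply: basis_summandP => [//|x Gx a b|x Gx a b].
    by rewrite /entry /= r12.
  by rewrite codomE map_id mem_enum.
exact: thick_basis_retract hs.
Qed.

(** A tensor ideal that contains the unit contains everything. *)
Lemma prime_unit P : prime_ideal P -> ~ P (tt_unit (stab k G)).
Proof.
move=> pP P1; apply: (prime_proper pP); rewrite eqEsubset; split=> // M _.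
apply: thick_tens_unit (prime_thick pP) _.
exact: prime_tensor pP (M : stab k G) _ P1.
Qed.
End Tensor.

(** * Preimages of primes *)

Section Preimage.
Local Open Scope ring_scope.
Local Open Scope classical_set_scope.

Lemma is_iso_sym (K : ttCat) (A B : K) (f : tt_hom A B) :
  is_iso f -> exists g : tt_hom B A, is_iso g.
Proof. by move=> [g [gf fg]]; exists g, f. Qed.

Lemma fmor0 (K L : ttCat) (F : exact_functor K L) (A B : K) :
  fmor F (0 : tt_hom A B) = 0.
Proof. by apply: (addrI (fmor F (0 : tt_hom A B))); rewrite -fmorD !addr0. Qed.

(** An exact functor preserves zero objects, isomorphisms, shifts, triangles and
    biproducts. *)
Lemma thick_preimage (K L : ttCat) (F : exact_functor K L) (P : set L) :
  thick_subcategory P -> thick_subcategory [set A | P (F A)].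
Proof.
move=> tP; split.
- move=> A A0 /=; apply: (thick_zero tP).
  by rewrite -fmor1 A0 fmor0.
- move=> A B f [g [gf fg]] /=; apply: (thick_iso tP (f := fmor F f)).
  by exists (fmor F g); rewrite -!fmorM gf fg !fmor1.
- move=> A /=; apply: iff_trans (thick_shift tP (F A)).
  have [g gi] := is_iso_sym (fshift_iso F A).
  by split; apply: (thick_iso tP); [exact: fshift_iso|exact: gi].
- move=> A B C u v w T.
  exact: (thick_triangle tP (ftriangle F T)).
- move=> A B S [i1 [i2 [p1 [p2 [e1 e2 e3 e4 e5]]]]] /=.
  apply: (thick_summand tP).
  exists (fmor F i1), (fmor F i2), (fmor F p1), (fmor F p2).
  by rewrite -!fmorM -fmorD e1 e2 e3 e4 e5 !fmor1 !fmor0.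
Qed.
End Preimage.

Section ResPrime.
Local Open Scope ring_scope.
Local Open Scope classical_set_scope.
Variables (k : fieldType) (gT : finGroupType) (G H : {group gT}).
Hypothesis sHG : H \subset G.

(** Restriction is compatible with tensor products and with the unit. *)
Lemma prime_preimage_res (P : set (stab k H)) : prime_ideal P ->
  prime_ideal [set M : stab k G | P (stab_res k sHG M)].
Proof.
move=> pP; have tP := prime_thick pP.
have resT M N : P (res sHG (tens M N)) <-> P (tens (res sHG M) (res sHG N)).
  by split; apply: thick_eq_repr tP.
split.
- exact: (@thick_preimage _ _ (stab_res k sHG)).
- move=> PT; apply: (prime_unit pP).
  have : P (res sHG (triv_rep k G)).
    by rewrite -[P _]/([set M : stab k G | P (stab_res k sHG M)] (triv_rep k G)) PT.
  exact: thick_eq_repr tP.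
- by move=> M N PN; apply/resT; apply: (prime_tensor pP).
- by move=> M N /resT /(prime_prime pP).
Qed.

Definition Spc_res (P : Spc (stab k H)) : Spc (stab k G) :=
  MkSpc (prime_preimage_res (Spc_prime P)).
End ResPrime.

(** * Tensor induction and elementary symmetric functions *)

Section SubBasis.
Local Open Scope ring_scope.
Variables (k : fieldType) (gT : finGroupType) (L : {group gT}) (B : finType).
Variables (rho : gT -> B -> B -> k) (D : pred B).
Hypothesis rho1 : forall a b, rho 1%g a b = (a == b)%:R.
Hypothesis rhoM : {in L &, forall x y a c,
  rho (x * y)%g a c = \sum_b rho x a b * rho y b c}.
Hypothesis rhoD : {in L, forall x a b, D a -> ~~ D b -> rho x a b = 0}.
Definition sub_coef x (a b : {b | D b}) := rho x (val a) (val b).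

Lemma sub_coef1 a b : sub_coef 1%g a b = (a == b)%:R.
Proof. by rewrite /sub_coef rho1. Qed.

(** The coefficients from D to its complement vanish, so a product of matrices is
    computed inside D. *)
Lemma sub_coefM : {in L &, forall x y a c,
  sub_coef (x * y)%g a c = \sum_b sub_coef x a b * sub_coef y b c}.
Proof.
move=> x y Lx Ly [a Da] c; rewrite /sub_coef rhoM //= (bigID D) /=.
rewrite [X in _ + X]big1 ?addr0 => [|b Db]; last by rewrite rhoD // mul0r.
rewrite (reindex_omap val (insub : B -> option {b | D b})) /=.
  by apply: eq_bigl => b; rewrite valK eqxx andbT; apply: valP.
by move=> b Db; rewrite insubT.
Qed.

Definition sub_basis_rep := basis_rep sub_coef1 sub_coefM.
End SubBasis.

Section OptRep.
Local Open Scope ring_scope.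
Variables (k : fieldType) (gT : finGroupType) (H : {group gT}).
Variable X : representation k H.
Local Notation d := (rdegree X).

(** The matrix coefficients of k (+) X, with [None] the basis vector of k. *)
Definition opt_coef (x : gT) (a b : option 'I_d) : k :=
  match a, b with
  | Some i, Some j => X x i j
  | None, None => 1
  | _, _ => 0
  end.

Lemma opt_coef1 a b : opt_coef 1%g a b = (a == b)%:R.
Proof. by case: a b => [i|] [j|] //=; rewrite repr_mx1 mxE. Qed.

Lemma sum_option (T : finType) (F : option T -> k) :
  \sum_o F o = F None + \sum_t F (Some t).
Proof.
rewrite (bigD1 None) //=; congr (_ + _).
rewrite (reindex_omap Some id) => [|[t|] //]; apply: eq_bigl => t.
by rewrite /= eqxx.
Qed.

Lemma opt_coefM : {in H &, forall x y a c,
  opt_coef (x * y)%g a c = \sum_b opt_coef x a b * opt_coef y b c}.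
Proof.
move=> x y Hx Hy a c; rewrite sum_option; case: a c => [i|] [j|] /=.
- by rewrite mul0r add0r repr_mxM // mxE.
- by rewrite mul0r add0r big1 // => t _; rewrite mulr0.
- by rewrite mulr0 add0r big1 // => t _; rewrite mul0r.
- by rewrite mulr1 big1 ?addr0 // => t _; rewrite mul0r.
Qed.
End OptRep.
Arguments opt_coef {k gT H} X x a b.

Section TensorInduction.
Local Open Scope ring_scope.
Variables (k : fieldType) (gT : finGroupType) (G H : {group gT}).
Hypothesis sHG : H \subset G.
Variables (I : finType) (act : I -> gT -> I) (tr : I -> gT) (c0 : I).
Hypothesis act1 : forall c, act c 1%g = c.
Hypothesis actM : {in G &, forall x y c, act c (x * y)%g = act (act c x) y}.
(** The element h of H with [tr c * x = h * tr (act c x)]. *)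
Definition cocyc c x := (tr c * x * (tr (act c x))^-1)%g.
Hypothesis cocycH : {in G, forall x c, cocyc c x \in H}.
Hypothesis tr0 : tr c0 = 1%g.
Hypothesis act0 : {in H, forall x, act c0 x = c0}.

Lemma translK x : x \in G -> cancel (act^~ x) (act^~ x^-1%g).
Proof. by move=> Gx c; rewrite -actM ?groupV // mulgV act1. Qed.

Lemma translKV x : x \in G -> cancel (act^~ x^-1%g) (act^~ x).
Proof. by move=> Gx c; rewrite -actM ?groupV // mulVg act1. Qed.

Lemma transl_bij x : x \in G -> bijective (act^~ x).
Proof. by move=> Gx; exists (act^~ x^-1%g); [apply: translK | apply: translKV]. Qed.

Lemma cocyc1 c : cocyc c 1%g = 1%g.
Proof. by rewrite /cocyc act1 mulg1 mulgV. Qed.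

Lemma cocycM : {in G &, forall x y c,
  cocyc c (x * y)%g = (cocyc c x * cocyc (act c x) y)%g}.
Proof. by move=> x y Gx Gy c; rewrite /cocyc actM // !mulgA mulgKV. Qed.

Lemma cocyc0 x : x \in H -> cocyc c0 x = x.
Proof. by move=> Hx; rewrite /cocyc act0 // tr0 mul1g invg1 mulg1. Qed.

Lemma transl_eq0 x c : x \in H -> (act c x == c0) = (c == c0).
Proof.
move=> Hx; have Gx := fintype.subsetP sHG x Hx.
by rewrite -{1}(act0 Hx) (inj_eq (bij_inj (transl_bij Gx))).
Qed.

Variable X : representation k H.
Local Notation B := {ffun I -> option 'I_(rdegree X)}.
Implicit Types a b : B.

(** The tensor induction of k (+) X from H to G. A basis vector a is a choice of a
    basis vector of k (+) X in each factor, and the factors are indexed by the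
    cosets I, with coset representatives tr. *)
Definition tind_coef (x : gT) a b : k :=
  \prod_c opt_coef X (cocyc c x) (a c) (b (act c x)).

Lemma tind_coef1 a b : tind_coef 1%g a b = (a == b)%:R.
Proof.
rewrite /tind_coef; under eq_bigr => c _ do rewrite cocyc1 act1 opt_coef1.
case: eqP => [->|ab]; first by rewrite big1 // => c _; rewrite eqxx.
have [c abc] : exists c, a c != b c.
  apply/existsP; apply: contra_notT ab => /existsPn h.
  by apply/ffunP=> c; apply/eqP; rewrite -[_ == _]negbK h.
by rewrite (bigD1 c) //= (negPf abc) mul0r.
Qed.

(** A product of sums is a sum over choice functions; the choice at coset c is the
    value at act c x of the intermediate basis vector, which explains the
    reindexing. *)
Lemma tind_coefM : {in G &, forall x y a c,
  tind_coef (x * y)%g a c = \sum_b tind_coef x a b * tind_coef y b c}.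
Proof.
move=> x y Gx Gy a c; rewrite /tind_coef.
under eq_bigr => i _ do rewrite cocycM // actM // opt_coefM ?cocycH //.
rewrite bigA_distr_bigA /=.
rewrite (reindex (fun b : B => [ffun i => b (act i x)])) /=; last first.
  exists (fun b : B => [ffun i => b (act i x^-1%g)]) => b _; apply/ffunP=> i;
  by rewrite !ffunE ?translK ?translKV.
apply: eq_bigr => b _; rewrite [X in _ = _ * X](reindex (act^~ x)) /=; last first.
  exact/onW_bij/transl_bij.
by rewrite -big_split; apply: eq_bigr => i _; rewrite !ffunE.
Qed.

(** The trivial summand and X do not mix. *)
Lemma tind_coef_supp x a b c : isSome (a c) != isSome (b (act c x)) ->
  tind_coef x a b = 0.
Proof.
move=> abc; rewrite /tind_coef (bigD1 c) //=.
by case: (a c) (b _) abc => [i|] [j|] //= _; rewrite mul0r.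
Qed.

(** The number of factors in which the basis vector comes from X: this grades the
    tensor induction of k (+) X. *)
Definition supp_size a := (\sum_c isSome (a c))%N.

Lemma tind_coef_size x a b : x \in G -> supp_size a != supp_size b -> tind_coef x a b = 0.
Proof.
move=> Gx ab; suff [c] : exists c, isSome (a c) != isSome (b (act c x)).
  exact: tind_coef_supp.
apply/existsP; apply: contraNT ab => /existsPn h; apply/eqP.
rewrite /supp_size [RHS](reindex (act^~ x)) /=; last exact/onW_bij/transl_bij.
by apply: eq_bigr => c _; have := h c; rewrite negbK => /eqP ->.
Qed.

Definition deg j : pred B := fun b => supp_size b == j.
(** The basis vectors of degree j with the trivial vector in the factor of the
    coset H; this set is preserved by H, since H fixes that coset. *)
Definition deg0 j : pred B := fun b => (supp_size b == j) && ~~ isSome (b c0).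

Fact deg_inv j :
  {in G, forall x a b, deg j a -> ~~ deg j b -> tind_coef x a b = 0}.
Proof.
by move=> x Gx a b /eqP <- bj; apply: tind_coef_size; rewrite 1?eq_sym.
Qed.

Fact deg0_inv j :
  {in H, forall x a b, deg0 j a -> ~~ deg0 j b -> tind_coef x a b = 0}.
Proof.
move=> x Hx a b /andP[/eqP aj a0]; rewrite negb_and negbK => /orP[bj|b0].
  by apply: tind_coef_size; rewrite ?aj 1?eq_sym // (fintype.subsetP sHG).
by apply: (tind_coef_supp (c := c0)); rewrite act0 // b0 (negPf a0).
Qed.

Fact tind_coefMH : {in H &, forall x y a c,
  tind_coef (x * y)%g a c = \sum_b tind_coef x a b * tind_coef y b c}.
Proof. by move=> x y Hx Hy; apply: tind_coefM; apply: (fintype.subsetP sHG). Qed.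

(** The representations e_j(X) of G and f_j(X) of H. *)
Definition esym_rep j : representation k G :=
  sub_basis_rep tind_coef1 tind_coefM (@deg_inv j).
Definition fsym_rep j : representation k H :=
  sub_basis_rep tind_coef1 tind_coefMH (@deg0_inv j).

Definition fsym_incl j (a : {b | deg0 j b}) : {b | deg j b} :=
  exist (deg j) (val a) (proj1 (andP (valP a))).

(** The basis vector of the summand f_j (x) X of e_(j+1): the factor at the coset
    H, which is trivial in f_j, is filled with a basis vector of X. *)
Definition fill0 a (i : 'I_(rdegree X)) : B :=
  [ffun c => if c == c0 then Some i else a c].

Lemma supp_size_fill a i : a c0 = None -> supp_size (fill0 a i) = (supp_size a).+1.
Proof.
move=> a0; rewrite /supp_size (bigD1 c0) //= ffunE eqxx /= [in RHS](bigD1 c0) //= a0.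
rewrite add0n add1n; congr (_.+1); apply: eq_bigr => c c_0.
by rewrite ffunE (negPf c_0).
Qed.

Fact fill0_deg j (ai : {b | deg0 j b} * 'I_(rdegree X)) :
  deg j.+1 (fill0 (val ai.1) ai.2).
Proof.
case: ai => -[a /= /andP[/eqP aj a0]] i; rewrite /deg supp_size_fill ?aj //.
by case: (a c0) a0.
Qed.
Definition fsym_fill j (ai : {b | deg0 j b} * 'I_(rdegree X)) : {b | deg j.+1 b} :=
  exist (deg j.+1) (fill0 (val ai.1) ai.2) (fill0_deg ai).

Definition eframe j : frame (rdegree (esym_rep j)) {b | deg j b} := enum_frame _.
Definition fframe j : frame (rdegree (fsym_rep j)) {b | deg0 j b} := enum_frame _.

Lemma mem_fsym_incl j (b : {b | deg j b}) :
  (b \in codom (@fsym_incl j)) = ~~ isSome (val b c0).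
Proof.
apply/codomP/idP => [[[a /= /andP[aj a0]] ->] //|b0].
have bd : deg0 j (val b) by rewrite /deg0 b0 andbT; apply: (valP b).
by exists (exist (deg0 j) (val b) bd); apply: val_inj.
Qed.

Lemma mem_fsym_fill j (b : {b | deg j.+1 b}) :
  (b \in codom (@fsym_fill j)) = isSome (val b c0).
Proof.
apply/codomP/idP => [[a ->] /=|]; first by rewrite ffunE eqxx.
case bi : (val b c0) => [i|//] _.
pose a : B := [ffun c => if c == c0 then None else val b c].
have a0 : a c0 = None by rewrite ffunE eqxx.
have ba : val b = fill0 a i.
  by apply/ffunP => c; rewrite !ffunE; case: eqP => [->|].
have ad : deg0 j a.
  rewrite /deg0 a0 andbT; have := valP b.
  by rewrite /= /deg ba supp_size_fill.
by exists (exist (deg0 j) a ad, i); apply: val_inj.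
Qed.

Lemma fsym_incl_summand j :
  basis_summand (M := fsym_rep j) (S := res sHG (esym_rep j))
    (fframe j) (eframe j) (@fsym_incl j).
Proof.
apply: basis_summandP.
- by move=> a b /(congr1 val) /= /val_inj.
- by move=> x Hx a b; rewrite !basis_repE.
- move=> x Hx a b; rewrite mem_fsym_incl negbK => b0; rewrite !basis_repE /sub_coef /=.
  have a0 : isSome (val a c0) = false by case/andP: (valP a) => _ /negPf.
  by split; apply: (tind_coef_supp (c := c0)); rewrite act0 // b0 a0.
Qed.

(** On the coset H an element x of H acts through its own matrix on X, because
    the representative of H is 1. *)
Lemma fsym_fill_summand j :
  basis_summand (M := tens (fsym_rep j) X) (S := res sHG (esym_rep j.+1))
    (tframe (fframe j) (ord_frame _)) (eframe j.+1) (@fsym_fill j).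
Proof.
have none (a : {b | deg0 j b}) : val a c0 = None.
  by case/andP: (valP a) => _; case: (val a c0).
apply: basis_summandP.
- move=> [a i] [b l] /(congr1 val) /= ab.
  have /ffunP ab' := ab; have := ab' c0; rewrite !ffunE eqxx => -[->].
  congr (_, _); apply: val_inj; apply/ffunP => c; have := ab' c.
  by rewrite !ffunE; case: eqP => [->|//]; rewrite !none.
- move=> x Hx [a i] [b l]; rewrite tens_entry !basis_repE /sub_coef /= /tind_coef.
  rewrite (bigD1 c0) //= [X in _ = X * _](bigD1 c0) //=.
  rewrite !cocyc0 // act0 // !ffunE eqxx !none /= mul1r mulrC; congr (_ * _).
  apply: eq_bigr => c c_0; rewrite !ffunE transl_eq0 // (negPf c_0) //.
- move=> x Hx a b; rewrite mem_fsym_fill => b0; rewrite !basis_repE /sub_coef /=.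
  by split; apply: (tind_coef_supp (c := c0)); rewrite act0 // ffunE eqxx /= (negPf b0).
Qed.

(** A vector of f_j has a trivial factor, so j is less than the number of factors. *)
Lemma fsym_top (b : {b | deg0 #|I| b}) : False.
Proof.
case: b => b /= /andP[/eqP bI b0].
have : (supp_size b < #|I|)%N; last by rewrite bI ltnn.
rewrite /supp_size -sum1_card (bigD1 c0) //= (negPf b0) [X in (_ < X)%N](bigD1 c0) //=.
by rewrite add0n add1n ltnS leq_sum // => c _; case: (isSome _).
Qed.

Lemma fsym0 (b : {b | deg0 0 b}) c : val b c = None.
Proof.
case: b => b /= /andP[]; rewrite /supp_size sum_nat_eq0 => /forallP/(_ c) /=.
by case: (b c).
Qed.

Fact none_deg0 : deg0 0 [ffun=> None].
Proof.
rewrite /deg0 ffunE andbT /supp_size big1 // => c _.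
by rewrite ffunE.
Qed.

Lemma fsym0_summand :
  basis_summand (M := triv_rep k H) (S := fsym_rep 0) (ord_frame 1) (fframe 0)
    (fun=> exist (deg0 0) _ none_deg0).
Proof.
apply: basis_summandP => [i j _|x Hx i j|x Hx i b].
- by rewrite [i]ord1 [j]ord1.
- rewrite basis_repE [RHS]entry1 [i]ord1 [j]ord1 eqxx /sub_coef /= /tind_coef big1 // => c _.
  by rewrite !ffunE.
- case/codomP; exists 0; apply: val_inj; apply/ffunP => c.
  by rewrite fsym0 ffunE.
Qed.

Local Open Scope classical_set_scope.

(** Descending induction on j shows that all f_j are in P, as explained at the
    top; it starts with the zero module f_|I| and ends with the unit f_0. *)
Lemma tensind_incomparable (P Q : set (stab k H)) :
  prime_ideal P -> prime_ideal Q -> P `<=` Q ->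
  (forall M : stab k G, Q (res sHG M) -> P (res sHG M)) -> Q X -> P X.
Proof.
move=> pP pQ PQ QP QX; apply: contrapT => PX.
have tP := prime_thick pP; have tQ := prime_thick pQ.
have P0 : P (fsym_rep 0).
  suff: forall j, (j <= #|I|)%N -> P (fsym_rep (#|I| - j)%N).
    by move/(_ _ (leqnn _)); rewrite subnn.
  elim=> [_|j IH jI].
    rewrite subn0; apply: (thick_zero tP).
    rewrite -[LHS]/(stab_pi (mid (fsym_rep #|I|))) -stab_pi0; congr stab_pi.
    apply: mhom_inj; apply: (entry_inj (e := fframe _) (f := fframe _)) => a.
    by case: (fsym_top a).
  have := IH (ltnW jI); rewrite -[(#|I| - j)%N](subnSK jI).
  move: (#|I| - j.+1)%N => {IH jI}j Pf.
  have : P (tens (fsym_rep j) X).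
    apply: thick_basis_retract (fsym_fill_summand j) tP _.
    apply/QP/(thick_basis_sum (fsym_incl_summand j.+1) (fsym_fill_summand j)) => //.
    - by move=> b; rewrite mem_fsym_fill mem_fsym_incl negbK.
    - exact: PQ.
    - exact: prime_tensor pQ (fsym_rep j : stab k H) _ QX.
  by case/(prime_prime pP (A := fsym_rep j : stab k H)).
apply: (prime_unit pP); exact: thick_basis_retract fsym0_summand tP P0.
Qed.
End TensorInduction.

(** * The action on cosets and incomparability *)

Section Cosets.
Local Open Scope ring_scope.
Variables (gT : finGroupType) (G H : {group gT}).
Hypothesis sHG : H \subset G.

Definition coset_idx : finType := {c : {set gT} | c \in rcosets H G}.

Fact coset0_subproof : (H : {set gT}) \in rcosets H G.
Proof. by apply/rcosetsP; exists 1%g; rewrite // mulg1. Qed.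
Definition coset0 : coset_idx := exist _ (H : {set gT}) coset0_subproof.

(** The fallback value of [insubd] is only taken for x outside G. *)
Definition coset_act (c : coset_idx) (x : gT) : coset_idx :=
  insubd c (val c :* x)%g.
Definition coset_tr (c : coset_idx) : gT := fingroup.repr (val c).

Lemma coset_trP c : coset_tr c \in G /\ val c = (H :* coset_tr c)%g.
Proof.
case: c => c cP; rewrite /coset_tr /=; case/rcosetsP: (cP) => g Gg ->.
split; last by rewrite rcoset_repr.
by have [h Hh] := repr_rcosetP H g; rewrite groupM // (fintype.subsetP sHG).
Qed.

Lemma val_coset_act c x : x \in G -> val (coset_act c x) = (val c :* x)%g.
Proof.
move=> Gx; rewrite /coset_act insubdK //; have [Gt ->] := coset_trP c.
by rewrite -rcosetM; apply/rcosetsP; exists (coset_tr c * x)%g; rewrite ?groupM.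
Qed.

Lemma coset_act1 c : coset_act c 1%g = c.
Proof. by apply: val_inj; rewrite val_coset_act ?group1 // mulg1. Qed.

Lemma coset_actM : {in G &, forall x y c,
  coset_act c (x * y)%g = coset_act (coset_act c x) y}.
Proof.
by move=> x y Gx Gy c; apply: val_inj; rewrite !val_coset_act ?groupM // rcosetM.
Qed.

Lemma coset_cocycH : {in G, forall x c, cocyc coset_act coset_tr c x \in H}.
Proof.
move=> x Gx c; rewrite /cocyc -mem_rcoset.
have [_ <-] := coset_trP (coset_act c x).
rewrite val_coset_act // mem_rcoset mulgK.
have [_ ->] := coset_trP c; exact: rcoset_refl.
Qed.

Lemma coset_tr0 : coset_tr coset0 = 1%g.
Proof. exact: repr_group. Qed.

Lemma coset_act0 x : x \in G -> (coset_act coset0 x == coset0) = (x \in H).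
Proof.
move=> Gx; rewrite -val_eqE /= val_coset_act //=.
apply/eqP/idP => [<-|Hx]; first exact: rcoset_refl.
exact: rcoset_id.
Qed.
End Cosets.

Section Incomparable.
Local Open Scope ring_scope.
Local Open Scope classical_set_scope.
Variables (k : fieldType) (gT : finGroupType) (G H : {group gT}).
Hypothesis sHG : H \subset G.

Theorem Spc_res_incomparable (P Q : Spc (stab k H)) :
  (P : set _) `<=` (Q : set _) ->
  (Spc_res sHG Q : set _) `<=` (Spc_res sHG P : set _) ->
  (Q : set _) `<=` (P : set _).
Proof.
move=> PQ QP X; apply: (tensind_incomparable (sHG := sHG)
  (act := @coset_act _ G H) (tr := @coset_tr _ G H) (c0 := @coset0 _ G H)
  (coset_act1 sHG) (coset_actM sHG) (coset_cocycH sHG) (coset_tr0 G H) _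
  (Spc_prime P) (Spc_prime Q) PQ QP).
move=> x Hx; apply/eqP; rewrite coset_act0 //.
exact: (fintype.subsetP sHG).
Qed.
End Incomparable.

(** * The thick ideal of projective modules *)

Section Projectives.
Local Open Scope ring_scope.
Variables (k : fieldType) (gT : finGroupType) (G : {group gT}).
Implicit Types A B M N S : representation k G.

Lemma rel_traceD M N (phi psi : 'M[k]_(rdegree M, rdegree N)) :
  rel_trace (phi + psi) = rel_trace phi + rel_trace psi.
Proof.
rewrite /rel_trace -big_split; apply: eq_bigr => x _.
by rewrite mulmxDr mulmxDl.
Qed.

(** By Higman's criterion. *)
Lemma stab_zeroP M : stab_pi (mid M) = 0 <-> trace_projective M.
Proof.
rewrite -stab_pi0; split=> [/stab_pi_eq/via_projP[phi e]|[phi e]].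
  by exists phi; rewrite -e mhom_mxB subr0.
apply/stab_pi_eq/via_projP; exists phi.
by rewrite mhom_mxB subr0 e.
Qed.

(** An endomorphism f of a module with 1 = Tr phi is Tr (f phi), a sum of |G|
    conjugates of one matrix. *)
Lemma trace_projective_trace0 M (f : mhom M M) :
  #|G|%:R = 0 :> k -> trace_projective M -> \tr f = 0.
Proof.
move=> G0 [phi e]; rewrite -[mhom_mx f]mulmx1 -e rel_trace_mull /rel_trace.
rewrite raddf_sum /= (eq_bigr (fun=> \tr (f *m phi))) => [|x Gx].
  by rewrite sumr_const -mulr_natl G0 mul0r.
by rewrite mxtrace_mulC mulmxA -repr_mxM ?groupV // mulgV repr_mx1 mul1mx.
Qed.

Lemma trace_projective_retract A S (i : mhom A S) (r : mhom S A) :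
  i *m r = 1%:M -> trace_projective S -> trace_projective A.
Proof.
move=> ir [phi e]; exists (i *m (phi *m r)).
by rewrite -rel_trace_mull -rel_trace_mulr e mul1mx.
Qed.

Lemma trace_projective_sum A B S (i1 : mhom A S) (i2 : mhom B S)
    (p1 : mhom S A) (p2 : mhom S B) : p1 *m i1 + p2 *m i2 = 1%:M ->
  trace_projective A -> trace_projective B -> trace_projective S.
Proof.
move=> e [phi ephi] [psi epsi].
exists (p1 *m (phi *m i1) + p2 *m (psi *m i2)).
by rewrite rel_traceD -!rel_trace_mull -!rel_trace_mulr ephi epsi !mul1mx.
Qed.

Lemma stab_comp0f A M N (f : stab_hom A M) : stab_comp (0 : stab_hom M N) f = 0.
Proof.
rewrite -[f]stab_reprK -!stab_pi0 stab_compE.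
by congr stab_pi; apply: mhom_inj; rewrite /= mulmx0.
Qed.

Lemma stab_compf0 A M N (f : stab_hom M N) : stab_comp f (0 : stab_hom A M) = 0.
Proof.
rewrite -[f]stab_reprK -!stab_pi0 stab_compE.
by congr stab_pi; apply: mhom_inj; rewrite /= mul0mx.
Qed.

Lemma trace_projective_stab A S (i : stab_hom A S) (r : stab_hom S A) :
  stab_comp r i = stab_pi (mid A) -> trace_projective S -> trace_projective A.
Proof.
move=> ri /stab_zeroP S0; apply/stab_zeroP.
by rewrite -ri -[i]stab_comp1f S0 stab_comp0f stab_compf0.
Qed.

Section Exact.
Variables (A B : representation k G) (f : mhom A B).
Hypothesis ff : row_free f.

(** An averaged linear retraction: with Tr phi = 1 on A, the trace of r0 phi is
    an equivariant retraction if r0 is a linear one. *)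
Lemma split_of_sub : trace_projective A -> exists r : mhom B A, f *m r = 1%:M.
Proof.
move=> [phi e]; have /row_freeP[r0 fr0] := ff.
exists (MHom (rel_trace_subproof (r0 *m phi))) => /=.
by rewrite rel_trace_mull mulmxA fr0 mul1mx.
Qed.

(** An averaged linear section s splits the projection; 1 - s o proj then takes
    values in A and is a retraction of f. *)
Lemma split_of_coker : trace_projective (coker f) ->
  exists r : mhom B A, f *m r = 1%:M.
Proof.
move=> [phi e].
pose s : mhom (coker f) B := MHom (rel_trace_subproof (phi *m coker_sec f)).
have sp : s *m coker_proj f = 1%:M.
  have -> : mhom_mx s = rel_trace (phi *m coker_sec f) by [].
  rewrite (rel_trace_mulr _ (coker_proj f)) -mulmxA.
  by rewrite coker_secK mulmx1 e.
pose q := mid B - mcomp s (coker_proj f).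
(* The rows of q = 1 - s o proj are killed by proj, hence are in the span of f. *)
have /submxP[W qW] : (q <= f)%MS.
  have : q *m coker_proj f = 0.
    by rewrite mhom_mxB mcompE mulmxBl mul1mx -mulmxA sp mulmx1 subrr.
  by move/eqP; rewrite /= -in_factmodE in_factmod_eq0 genmxE.
have Wf : W \is a equivariant B A.
  apply/equivariantP => x Gx; apply: (row_free_inj ff).
  by rewrite -(mulmxA _ W) -qW mhomE // qW -!mulmxA mhomE.
exists (MHom Wf); apply: (row_free_inj ff).
rewrite -[mhom_mx (MHom Wf)]/W -mulmxA -qW mul1mx mhom_mxB mcompE mulmxBr mulmx1 mulmxA.
by rewrite (coker_proj0 f) mul0mx subr0.
Qed.

Lemma coker_projective :
  trace_projective A -> trace_projective B -> trace_projective (coker f).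
Proof.
move=> /split_of_sub[r /split_coker[s [sp _ _]]].
exact: trace_projective_retract sp.
Qed.

Lemma sub_projective :
  trace_projective B -> trace_projective (coker f) -> trace_projective A.
Proof.
move=> pB /split_of_coker[r fr].
exact: trace_projective_retract fr pB.
Qed.

Lemma mid_projective :
  trace_projective A -> trace_projective (coker f) -> trace_projective B.
Proof.
move=> pA pC; have [r fr] := split_of_sub pA.
have [s [_ _ e]] := split_coker fr.
exact: trace_projective_sum e pA pC.
Qed.
End Exact.

Lemma cone_in_free M N (f : mhom M N) : row_free (cone_in f).
Proof.
have /row_freeP[r er] := emb_free M.
apply/row_freeP; exists (col_mx 0 (- r)).
by rewrite /= mul_row_col mulmx0 add0r mulmxN mulNmx opprK.
Qed.

(** The middle term of the exact sequence M -> N (+) kG (x) M -> cone f. *)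
Lemma dadd_projective M N :
  trace_projective (dadd_grepr N (free_tens M)) <-> trace_projective N.
Proof.
have e1 : dadd_inl N (free_tens M) *m dadd_desc (mid N) (0 : mhom (free_tens M) N) = 1%:M.
  by rewrite /= mul_row_col mulmx1 mulmx0 addr0.
split; first exact: trace_projective_retract e1.
move=> pN; have pF := free_tens_projective M; move: pN pF.
apply: (trace_projective_sum
  (p1 := dadd_desc (mid N) (0 : mhom (free_tens M) N))
  (p2 := dadd_desc (0 : mhom N (free_tens M)) (mid _))
  (i1 := dadd_inl N (free_tens M)) (i2 := dadd_inr N (free_tens M))).
rewrite /= !mul_col_row !mul1mx !mul0mx ?mulmx0.
by rewrite add_block_mx !addr0 !add0r -scalar_mx_block.
Qed.

Local Open Scope classical_set_scope.

Definition projectives : set (stab k G) := [set M | trace_projective (M : representation k G)].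

(** Shifts and cones are cokernels in exact sequences whose middle terms are, up
    to a free summand, known; so the two-out-of-three property of projectivity in
    short exact sequences suffices. *)
Lemma thick_projectives : thick_subcategory projectives.
Proof.
split.
- by move=> A /stab_zeroP.
- by move=> A B f [g [_ fg]]; apply: trace_projective_stab fg.
- move=> A; split=> h.
    exact: sub_projective (emb_free A) (free_tens_projective A) h.
  exact: coker_projective (emb_free A) h (free_tens_projective A).
- move=> A B C u v w [M [N [f [a [b [c [[ai bi ci] _]]]]]]].
  have tr (X Y : representation k G) (i : stab_hom X Y) : stab_iso i ->
      trace_projective X = trace_projective Y.
    move=> [j [ji ij]]; apply: propext.
    by split; [apply: trace_projective_stab ij|apply: trace_projective_stab ji].
  rewrite /projectives /= -(tr _ _ _ ai) -(tr _ _ _ bi) -(tr _ _ _ ci).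
  rewrite -(propext (dadd_projective M N)); split.
  + exact: coker_projective (cone_in_free f).
  + exact: sub_projective (cone_in_free f).
  + exact: mid_projective (cone_in_free f).
- move=> A B S [i1 [i2 [p1 [p2 [e1 e2 _ _ _]]]]] pS.
  by split; [apply: trace_projective_stab e1 pS|apply: trace_projective_stab e2 pS].
Qed.

Lemma tprodDr m1 n1 m2 n2 (C : 'M[k]_(m1, n1)) (A B : 'M_(m2, n2)) :
  tprod C (A + B) = tprod C A + tprod C B.
Proof.
apply: (entry_inj (e := pair_frame (ord_frame m1) (ord_frame m2))
  (f := pair_frame (ord_frame n1) (ord_frame n2))) => a b.
by rewrite entryD !tprod_entry entryD mulrDr.
Qed.

Lemma tprod_sumr (I : Type) (s : seq I) (P : pred I) m1 n1 m2 n2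
    (C : 'M[k]_(m1, n1)) (A : I -> 'M_(m2, n2)) :
  tprod C (\sum_(i <- s | P i) A i) = \sum_(i <- s | P i) tprod C (A i).
Proof.
apply: (big_morph (fun B : 'M[k]_(m2, n2) => tprod C B)) => [B B'|]; first exact: tprodDr.
by apply: (addrI (tprod C (0 : 'M_(m2, n2)))); rewrite -tprodDr !addr0.
Qed.

Lemma tens_projective M N : trace_projective N -> trace_projective (tens M N).
Proof.
move=> [phi e]; exists (tprod 1%:M phi).
rewrite /rel_trace /= (eq_bigr (fun x => tprod 1%:M (N x^-1%g *m phi *m N x))).
  by rewrite -tprod_sumr [X in tprod _ X]e tprod1.
by move=> x Gx; rewrite -!tprodE mulmx1 -repr_mxM ?groupV // mulVg repr_mx1.
Qed.
End Projectives.

(** * The trace criterion for cyclic groups of order p *)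

Section CharP.
Local Open Scope ring_scope.
Variables (k : fieldType) (p : nat).
Hypothesis char_k : p \in [pchar k].

Lemma natr_inj_lt i j : (i < p)%N -> (j < p)%N -> i%:R = j%:R :> k -> i = j.
Proof.
wlog ij : i j / (i <= j)%N => [hw|] ip jp e.
  by have /orP[/hw|/hw] := leq_total i j; [|symmetry]; auto.
have : (j - i)%:R = 0 :> k by rewrite natrB // e subrr.
move/eqP; rewrite -(dvdn_pcharf char_k) => /dvdn_leq h.
apply/eqP; rewrite eqn_leq ij /= -subn_eq0; apply: contraTT isT => nz.
have := h; rewrite lt0n nz => /(_ isT).
by rewrite leqNgt (leq_ltn_trans (leq_subr _ _) jp).
Qed.

(** The function t |-> 1 - (t - i)^(p-1) is the indicator of i on the prime field,
    by Fermat's little theorem. The sum of these functions is 1 at p points, and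
    its degree is less than p. *)
Lemma sum_shift_indicator :
  \sum_(i < p) (1 - ('X - i%:R%:P) ^+ p.-1) = 1 :> {poly k}.
Proof.
have p_gt0 : (0 < p)%N := prime_gt0 (pcharf_prime char_k).
apply/eqP; rewrite -subr_eq0; apply/negPn/negP => nz.
pose rs := [seq i%:R : k | i <- iota 0 p].
have uniq_rs : uniq rs.
  rewrite map_inj_in_uniq ?iota_uniq // => i j.
  by rewrite !mem_iota !add0n => /andP[_ ip] /andP[_ jp]; apply: natr_inj_lt.
have szp : (size (\sum_(i < p) (1 - ('X - i%:R%:P) ^+ p.-1) - 1 : {poly k})%R <= p)%N.
  have sz1 : (size (1%:P : {poly k}) <= p)%N.
    by rewrite size_polyC oner_neq0.
  apply: (leq_trans (size_polyD _ _)); rewrite size_polyN geq_max sz1 andbT.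
  apply: (leq_trans (size_sum _ _ _)); apply/bigmax_leqP => i _.
  apply: (leq_trans (size_polyD _ _)); rewrite size_polyN geq_max sz1 /=.
  by rewrite size_exp_XsubC prednK.
have /max_poly_roots := nz; move=> /(_ rs _ uniq_rs).
rewrite size_map size_iota => h; have : (p < p)%N; last by rewrite ltnn.
apply: leq_trans szp; apply: h; apply/allP => _ /mapP[j jp ->].
have {}jp : (j < p)%N by move: jp; rewrite mem_iota add0n => /andP[].
rewrite /root hornerD hornerN hornerC horner_sum (bigD1 (Ordinal jp)) //=.
rewrite big1 => [|i ij]; rewrite !hornerE.
  rewrite subrr; have -> : 0 ^+ p.-1 = 0 :> k.
    by rewrite expr0n eqn0Ngt -ltnS prednK // prime_gt1 // (pcharf_prime char_k).
  by rewrite subr0 subrr.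
have nz0 : j%:R - i%:R != 0 :> k.
  rewrite subr_eq0; apply: contra_neq ij => ji; apply: val_inj.
  exact: natr_inj_lt (ltn_ord i) jp (esym ji).
suff -> : (j%:R - i%:R) ^+ p.-1 = 1 :> k by rewrite subrr.
apply: (mulfI nz0); rewrite mulr1 -exprS prednK //.
rewrite -(pFrobenius_autE char_k) pFrobenius_autB_comm; last exact: mulrC.
by rewrite !pFrobenius_aut_nat.
Qed.
End CharP.

Section AdImage.
Local Open Scope ring_scope.
Variables (k : fieldType).

Lemma mxvec_pairing m n (A B : 'M[k]_(m, n)) :
  (mxvec A *m (mxvec B)^T) 0 0 = \tr (A *m B^T).
Proof.
rewrite mxE (reindex _ (curry_mxvec_bij _ _)) /=.
rewrite (eq_bigr (fun ij => A ij.1 ij.2 * B ij.1 ij.2)); last first.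
  by case=> i j _; rewrite mxE !mxvecE.
rewrite -(pair_bigA _ (fun i j => A i j * B i j)) /mxtrace.
by apply: eq_bigr => i _; rewrite mxE; apply: eq_bigr => j _; rewrite mxE.
Qed.

Lemma mxtrace_delta n (D : 'M[k]_n) i j : \tr (delta_mx i j *m D) = D j i.
Proof.
rewrite /mxtrace (bigD1 i) //= big1 => [|i' ni]; rewrite mxE (bigD1 j) //= big1 ?addr0.
- by rewrite mxE !eqxx mul1r.
- by move=> j' nj; rewrite mxE (negPf nj) andbF mul0r.
- by rewrite mxE (negPf ni) mul0r.
- by move=> j' nj; rewrite mxE (negPf nj) andbF mul0r.
Qed.

(** The map phi |-> phi - X^-1 phi X has an adjoint for the trace form, namely
    psi |-> psi - X psi X^-1, and an element that is orthogonal to the kernel of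
    the adjoint is in the image. Here the element is 1, and the kernel is the
    centralizer of X. *)
Lemma commutator_image n (X Y : 'M[k]_n) : X *m Y = 1%:M -> Y *m X = 1%:M ->
  (forall psi, X *m psi = psi *m X -> \tr psi = 0) ->
  exists phi, phi - Y *m phi *m X = 1%:M.
Proof.
move=> XY YX tr0; pose L := 1%:M - lin_mx (mulmx Y) *m lin_mx (mulmxr X).
have LE phi : mxvec phi *m L = mxvec (phi - Y *m phi *m X).
  by rewrite mulmxBr mulmx1 mulmxA !mul_vec_lin linearB.
suff /submxP[u uL] : (mxvec 1%:M <= L)%MS.
  exists (vec_mx u); apply: (can_inj mxvecK).
  by rewrite -LE vec_mxK uL.
rewrite submxE; apply/eqP/rowP => j; rewrite [RHS]mxE.
(* A column of c is a linear form that vanishes on the image; through the trace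
   form it is represented by a matrix B^T, which commutes with X. *)
set c := cokermx L; pose B := vec_mx (col j c)^T.
have cE A : (mxvec A *m c) 0 j = \tr (A *m B^T).
  rewrite -mxvec_pairing vec_mxK trmxK !mxE.
  by apply: eq_bigr => i _; rewrite [col _ _ _ _]mxE.
rewrite cE mul1mx; apply: tr0.
have BE : B^T = X *m B^T *m Y.
  apply/matrixP => i i'; rewrite -!(mxtrace_delta _ i' i).
  apply/eqP; rewrite -subr_eq0; apply/eqP.
  have := cE (delta_mx i' i - Y *m delta_mx i' i *m X).
  rewrite -LE -(mulmxA _ L c) (mulmx_coker L : L *m c = 0) mulmx0 mxE.
  rewrite mulmxBl linearB /= => e; rewrite [RHS]e.
  congr (_ - _); rewrite [RHS]mxtrace_mulC !mulmxA.
  by rewrite mxtrace_mulC !mulmxA mxtrace_mulC !mulmxA.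
by rewrite [in RHS]BE -mulmxA YX mulmx1.
Qed.
End AdImage.

Section CyclicP.
Local Open Scope ring_scope.
Variables (k : fieldType) (gT : finGroupType) (p : nat) (x : gT).
Hypotheses (char_k : p \in [pchar k]) (ox : #[x]%g = p).
Local Notation C := <[x]>%G.

Lemma sum_cycle (V : zmodType) (F : gT -> V) :
  \sum_(y in <[x]>%g) F y = \sum_(i < p) F (x ^+ i)%g.
Proof.
have inj : {in predT &, injective (fun i : 'I_p => x ^+ i)%g}.
  move=> i j _ _ /eqP; rewrite eq_expg_mod_order ox !modn_small // => /eqP.
  exact: val_inj.
rewrite -(big_imset _ inj) /=; apply: eq_bigl => y.
apply/idP/imsetP => [/cyclePmin[i ip ->]|[i _ ->]]; last exact: mem_cycle.
by rewrite ox in ip; exists (Ordinal ip).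
Qed.

Lemma conj_exp n (X Y A : 'M[k]_n.+1) j : X *m Y = 1%:M -> Y *m X = 1%:M ->
  Y *m A ^+ j *m X = (Y *m A *m X) ^+ j.
Proof.
move=> XY YX; elim: j => [|j IH]; first by rewrite !expr0 mulmx1 YX.
rewrite !exprS -IH -!mulmxE !mulmxA; congr (_ *m _ *m _).
by rewrite -[in RHS](mulmxA _ X Y) XY mulmx1.
Qed.

(** By [commutator_image] there is phi with x^-1 phi x = phi - 1, so conjugation by
    the powers of x turns phi into phi - i, for i in the prime field. The trace
    of 1 - phi^(p-1) is then the sum in [sum_shift_indicator], with phi
    substituted for the variable. *)
Lemma trace_zero_projective (M : representation k C) :
  (forall f : mhom M M, \tr f = 0) -> trace_projective M.
Proof.
case: M => n r tr0; pose M := Representation r.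
have Cx : x \in <[x]>%g := cycle_id x.
have XY i : r (x ^+ i)%g *m r ((x ^+ i)^-1)%g = 1%:M.
  by rewrite -repr_mxM ?groupV ?mem_cycle // mulgV repr_mx1.
have YX i : r ((x ^+ i)^-1)%g *m r (x ^+ i)%g = 1%:M.
  by rewrite -repr_mxM ?groupV ?mem_cycle // mulVg repr_mx1.
have [phi phiE] : exists phi, phi - r x^-1%g *m phi *m r x = 1%:M.
  apply: (commutator_image (XY 1) (YX 1)) => psi.
  rewrite expg1 => xpsi.
  have eqpsi : psi \is a equivariant M M.
    apply/equivariantP => y /cycleP[i ->] /=; elim: i => [|i IH].
      by rewrite expg0 repr_mx1 mul1mx mulmx1.
    rewrite expgS repr_mxM ?mem_cycle // -mulmxA IH !mulmxA; congr (_ *m _); exact: xpsi.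
  exact: (tr0 (MHom eqpsi)).
have conjE i : r ((x ^+ i)^-1)%g *m phi *m r (x ^+ i)%g = phi - i%:R%:M.
  elim: i => [|i IH].
    by rewrite expg0 invg1 repr_mx1 mul1mx mulmx1 raddf0 subr0.
  rewrite {1}expgSr expgSr invMg !repr_mxM ?groupV ?mem_cycle //.
  rewrite -!mulmxA (mulmxA phi) (mulmxA (r (x ^+ i)^-1%g)) (mulmxA (r (x ^+ i)^-1%g)) IH.
  rewrite mulmxBl mulmxBr mulmxA.
  have -> : r x^-1%g *m phi *m r x = phi - 1%:M.
    by rewrite -phiE opprB addrC subrK.
  rewrite mul_scalar_mx -scalemxAr -repr_mxM ?groupV // mulVg repr_mx1 scalemx1.
  by rewrite -addn1 natrD raddfD /= opprD addrA addrAC.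
(* Polynomials are evaluated at matrices of positive size. *)
case: n r tr0 @M phi phiE XY YX conjE => [|n] r tr0 M phi phiE XY YX conjE.
  by exists 0; apply/matrixP; case.
exists (1 - phi ^+ p.-1).
rewrite /rel_trace sum_cycle.
have := congr1 (horner_mx phi) (sum_shift_indicator char_k).
rewrite rmorph_sum rmorph1 => e; apply: etrans e; apply: eq_bigr => i _.
rewrite rmorphB rmorph1 rmorphXn rmorphB /= horner_mx_X horner_mx_C -conjE -conj_exp //.
by rewrite mulmxBr mulmxBl mulmx1 YX.
Qed.

Fact tens_map_subproof (M N : representation k C) (f : mhom M M) (g : mhom N N) :
  tprod f g \is a equivariant (tens M N) (tens M N).
Proof. by apply/equivariantP => y Cy; rewrite /= -!tprodE !mhomE. Qed.

Lemma nonprojective_trace (M : representation k C) :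
  ~ trace_projective M -> exists f : mhom M M, \tr f != 0.
Proof.
move=> npM; apply: contrapT => nof; apply/npM/trace_zero_projective => f.
by apply/eqP; apply: contra_notT nof => nz; exists f.
Qed.

Lemma natr_card_cycle_eq0 : #|C|%:R = 0 :> k.
Proof. by rewrite -[#|_|]/(#[x]%g) ox pcharf0. Qed.

(** If f and g are endomorphisms of M and N of nonzero trace, then f (x) g has
    nonzero trace, so M (x) N is not projective. *)
Lemma projectives_prime : prime_ideal (@projectives k gT C).
Proof.
split.
- exact: thick_projectives.
- move=> pT; have : projectives (triv_rep k C) by rewrite pT.
  move/(trace_projective_trace0 (mid _) natr_card_cycle_eq0) => /eqP.
  by rewrite /= mxtrace1 oner_eq0.
- by move=> M N; apply: tens_projective.
- move=> M N pMN; apply: contrapT => /not_orP[].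
  move=> /nonprojective_trace[f nf] /nonprojective_trace[g ng].
  have /eqP := trace_projective_trace0 (MHom (tens_map_subproof f g))
                 natr_card_cycle_eq0 pMN.
  by rewrite /= mxtrace_prod mulf_eq0 (negPf nf) (negPf ng).
Qed.

End CyclicP.

(** * The permutation module on the cosets of a subgroup *)

Section PermutationModule.
Local Open Scope ring_scope.
Variables (k : fieldType) (gT : finGroupType) (G C : {group gT}).
Hypothesis sCG : C \subset G.
Local Notation I := (coset_idx G C).
Local Notation act := (@coset_act _ G C).
Local Notation tr := (@coset_tr _ G C).
Local Notation c0 := (coset0 G C).

Definition perm_coef (x : gT) (a b : I) : k := (act a x == b)%:R.

Fact perm_coef1 a b : perm_coef 1%g a b = (a == b)%:R.
Proof. by rewrite /perm_coef coset_act1. Qed.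

Fact perm_coefM : {in G &, forall x y a c,
  perm_coef (x * y)%g a c = \sum_b perm_coef x a b * perm_coef y b c}.
Proof. by move=> x y Gx Gy a c; rewrite /perm_coef sum_delta coset_actM. Qed.

Definition perm_rep : representation k G := basis_rep perm_coef1 perm_coefM.
Definition pframe : frame (rdegree perm_rep) I := enum_frame _.

Lemma perm_repE x a b : entry pframe pframe (perm_rep x) a b = (act a x == b)%:R.
Proof. exact: basis_repE. Qed.

Lemma coset_actK x : x \in G -> cancel (act^~ x) (act^~ x^-1%g).
Proof. move=> Gx; exact (translK (coset_act1 sCG) (coset_actM sCG) Gx). Qed.

Lemma coset_actKV x : x \in G -> cancel (act^~ x^-1%g) (act^~ x).
Proof. move=> Gx; exact (translKV (coset_act1 sCG) (coset_actM sCG) Gx). Qed.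

Lemma coset_tr_act c : act c0 (tr c) = c.
Proof.
have [Gt cE] := coset_trP sCG c; apply: val_inj.
by rewrite val_coset_act //= -cE.
Qed.

(** The projection onto the line of the coset c. *)
Definition pt_mx (c : I) : 'M[k]_(rdegree perm_rep) :=
  mxf pframe pframe (fun a b => (a == c)%:R * (b == c)%:R).

Lemma pt_mxJ x c : x \in G ->
  perm_rep x^-1%g *m pt_mx c *m perm_rep x = pt_mx (act c x).
Proof.
move=> Gx; apply: (entry_inj (e := pframe) (f := pframe)) => a b.
rewrite (entryM _ pframe) mxfE.
under eq_bigr => b' _.
  rewrite (entryM _ pframe).
  under eq_bigr => a' _ do rewrite perm_repE mxfE.
  rewrite sum_delta perm_repE.
  over.
rewrite /=.
under eq_bigr do rewrite -mulrA.
rewrite -big_distrr /=; under eq_bigr do rewrite mulrC.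
rewrite sum_deltar eq_sym; congr (_%:R * _%:R); last by rewrite eq_sym.
by rewrite -(inj_eq (can_inj (coset_actK Gx))) coset_actKV // eq_sym.
Qed.

(** If phi has relative trace 1 over C, then the trace over G of the tensor product
    of phi with the projection onto the line of the coset C is 1: the terms
    with x in a fixed coset Ct contribute the identity on the line of Ct,
    tensored with the conjugate by t of the trace of phi over C. *)
Lemma trace_perm_tens (X : representation k G) :
  trace_projective (res sCG X) -> trace_projective (tens perm_rep X).
Proof.
move=> [phi phiE]; exists (tprod (pt_mx c0) phi).
rewrite /rel_trace /= (eq_bigr (fun x =>
  tprod (pt_mx (act c0 x)) (X x^-1%g *m phi *m X x))); last first.
  by move=> x Gx; rewrite -!tprodE pt_mxJ.
rewrite (partition_big (act c0) predT) //=.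
have sum1 : \sum_c pt_mx c = 1%:M.
  apply: (entry_inj (e := pframe) (f := pframe)) => a b.
  rewrite entry1.
  have -> : entry pframe pframe (\sum_c pt_mx c) a b = \sum_c (a == c)%:R * (b == c)%:R.
    by rewrite /entry summxE; apply: eq_bigr => c _; rewrite [LHS]mxfE.
  by rewrite sum_delta eq_sym.
transitivity (tprod (\sum_c pt_mx c) (1%:M : 'M[k]_(rdegree X))); last by rewrite sum1 tprod1.
rewrite tprod_sum; apply: eq_bigr => c _.
under eq_bigr => x /andP[_ /eqP ->] do [].
rewrite -tprod_sumr; congr (tprod _ _).
have [Gt _] := coset_trP sCG c.
rewrite (reindex_inj (mulIg (tr c))) /=.
transitivity (X (tr c)^-1%g *m (\sum_(h in C) X h^-1%g *m phi *m X h) *m X (tr c)).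
  rewrite mulmx_sumr mulmx_suml; apply: eq_big => [h|h /andP[Gh _]].
    rewrite groupMr //; apply/andP/idP => [[Gh]|Ch].
      rewrite (coset_actM sCG) // -[X in _ == X]coset_tr_act.
      by rewrite (inj_eq (can_inj (coset_actK Gt))) (coset_act0 sCG).
    have Gh := fintype.subsetP sCG h Ch; split => //.
    move: Ch; rewrite -(coset_act0 sCG) // (coset_actM sCG) // => /eqP ->.
    by rewrite coset_tr_act.
  rewrite groupMr // in Gh.
  by rewrite invMg !repr_mxM ?groupV // !mulmxA.
rewrite [X in _ *m X *m _](_ : _ = 1%:M) ?mulmx1; last by rewrite -phiE.
by rewrite -repr_mxM ?groupV // mulVg repr_mx1.
Qed.

(** C fixes the coset C, and the projection onto its line has trace 1. *)
Lemma perm_res_not_projective (H : {group gT}) (sCH : C \subset H) (sHG : H \subset G) :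
  #|C|%:R = 0 :> k ->
  ~ trace_projective (res sCH (res sHG perm_rep)).
Proof.
move=> C0 pK; pose M := res sCH (res sHG perm_rep).
have eqE : pt_mx c0 \is a equivariant M M.
  apply/equivariantP => y Cy; have Gy := fintype.subsetP sCG y Cy.
  have /eqP y0 : act c0 y == c0 by rewrite (coset_act0 sCG).
  suff : perm_rep y *m pt_mx c0 = pt_mx c0 *m perm_rep y by [].
  rewrite -[in LHS]y0 -pt_mxJ // !mulmxA -repr_mxM ?groupV // mulgV repr_mx1.
  by rewrite mul1mx.
have /eqP := trace_projective_trace0 (MHom eqE) C0 pK.
rewrite /= (mxtrace_entry pframe); under eq_bigr do rewrite mxfE.
by rewrite (sum_deltar c0 (fun j => (j == c0)%:R)) eqxx oner_eq0.
Qed.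

Section Dual.
Variable X : representation k G.

Fact dual_subproof : mx_repr G (fun x => (X x^-1%g)^T).
Proof.
split=> [|x y Gx Gy]; first by rewrite invg1 repr_mx1 trmx1.
by rewrite invMg repr_mxM ?groupV // trmx_mul.
Qed.
Definition dual : representation k G := Representation (MxRepresentation dual_subproof).
End Dual.

Section TraceRetract.
Variable X : representation k G.
Variable f : mhom (res sCG X) (res sCG X).
Local Notation d := (rdegree X).
Local Notation S := (tens (tens perm_rep (dual X)) X).

(** The conjugates of f. As f commutes with C, the conjugate by t only depends on
    the coset Ct. *)
Definition conj_hom (c : I) : 'M[k]_d := X (tr c)^-1%g *m f *m X (tr c).

Lemma conj_hom_act x c : x \in G ->
  conj_hom (act c x) = X x^-1%g *m conj_hom c *m X x.
Proof.
move=> Gx; have [Gt _] := coset_trP sCG c; have [Gt' _] := coset_trP sCG (act c x).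
have Ch : cocyc act tr c x \in C by apply: (coset_cocycH sCG).
have Gh := fintype.subsetP sCG _ Ch.
have htx : (tr c * x = cocyc act tr c x * tr (act c x))%g by rewrite /cocyc mulgKV.
have /= fh := mhomE f Ch; move: (cocyc _ _ _ _) Ch Gh htx fh => h Ch Gh htx fh.
rewrite /conj_hom !mulmxA -(mulmxA _ (X (tr c)) (X x)) -!repr_mxM ?groupV // -invMg htx.
rewrite invMg !repr_mxM ?groupV // !mulmxA; congr (_ *m _).
rewrite -!mulmxA; congr (_ *m _); rewrite -fh.
by rewrite mulmxA -repr_mxM ?groupV // mulVg repr_mx1 mul1mx.
Qed.

Definition sframe : frame (rdegree S) (I * 'I_d * 'I_d)%type :=
  tframe (tframe pframe (ord_frame (rdegree (dual X)))) (ord_frame d).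

Lemma perm_dual_tens_entry x (s t : (I * 'I_d * 'I_d)%type) :
  entry sframe sframe (S x) s t =
  (act s.1.1 x == t.1.1)%:R * X x^-1%g t.1.2 s.1.2 * X x s.2 t.2.
Proof. by rewrite !tens_entry perm_repE /entry /= [in LHS]mxE. Qed.

Lemma sum_pair3 (F : I -> 'I_d -> 'I_d -> k) :
  \sum_(s : (I * 'I_d * 'I_d)%type) F s.1.1 s.1.2 s.2 = \sum_b \sum_i \sum_j F b i j.
Proof.
rewrite -(pair_bigA _ (fun (bi : (I * 'I_d)%type) j => F bi.1 bi.2 j)) /=.
by rewrite -(pair_bigA _ (fun b i => \sum_j F b i j)).
Qed.

Fact tr_inc_subproof :
  mxf pframe sframe (fun a s => (a == s.1.1)%:R * conj_hom a s.1.2 s.2)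
    \is a equivariant perm_rep S.
Proof.
apply: mxf_equivariant => x Gx a [[b i] j] /=.
under eq_bigr do rewrite perm_repE.
rewrite sum_delta conj_hom_act //.
under [RHS]eq_bigr do rewrite perm_dual_tens_entry /=.
rewrite (sum_pair3 (fun b' i' j' => (a == b')%:R * conj_hom a i' j' *
  ((act b' x == b)%:R * X x^-1%g i i' * X x j' j))).
rewrite (eq_bigr (fun b' => (a == b')%:R * ((act b' x == b)%:R *
   (X x^-1%g *m conj_hom a *m X x) i j))) ?sum_delta // => b' _.
rewrite exchange_big /= [in RHS]mxE 2!big_distrr /=; apply: eq_bigr => j' _.
rewrite [in RHS]mxE big_distrl 2!big_distrr /=; apply: eq_bigr => i' _; ring.
Qed.
(** Sends the coset c to c tensored with the conjugate of f by c, viewed as an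
    element of X^* (x) X. *)
Definition tr_inc : mhom perm_rep S := MHom tr_inc_subproof.

Fact tr_proj_subproof :
  mxf sframe pframe (fun s b => (s.1.2 == s.2)%:R * (s.1.1 == b)%:R)
    \is a equivariant S perm_rep.
Proof.
apply: mxf_equivariant => x Gx [[b i] j] a /=.
under eq_bigr do rewrite perm_dual_tens_entry /=.
rewrite (sum_pair3 (fun b' i' j' => (act b x == b')%:R * X x^-1%g i' i * X x j j' *
  ((i' == j')%:R * (b' == a)%:R))).
under [RHS]eq_bigr do rewrite perm_repE -mulrA.
rewrite -big_distrr /= sum_delta.
rewrite (eq_bigr (fun b' => (act b x == b')%:R * ((b' == a)%:R * (i == j)%:R))) => [|b' _].
  by rewrite sum_delta mulrC.
rewrite (_ : (i == j)%:R = (X x *m X x^-1%g) j i); last first.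
  by rewrite -repr_mxM ?groupV // mulgV repr_mx1 mxE eq_sym.
rewrite mxE 2!big_distrr /=; apply: eq_bigr => i' _.
rewrite (eq_bigr (fun j' => (i' == j')%:R * ((act b x == b')%:R * X x^-1%g i' i * X x j j' *
   (b' == a)%:R))) => [|j' _]; last by ring.
rewrite sum_delta; ring.
Qed.
(** The evaluation X^* (x) X -> k, tensored with k[G/C]. *)
Definition tr_proj : mhom S perm_rep := MHom tr_proj_subproof.

Lemma tr_inc_proj : tr_inc *m tr_proj = (\tr f)%:M.
Proof.
apply: (entry_inj (e := pframe) (f := pframe)) => a a'.
rewrite (entryM _ sframe).
under eq_bigr do rewrite !mxfE.
rewrite (sum_pair3 (fun b i j => (a == b)%:R * conj_hom a i j *
   ((i == j)%:R * (b == a')%:R))).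
rewrite (eq_bigr (fun b => (a == b)%:R * ((b == a')%:R * \tr (conj_hom a)))) => [|b _].
  rewrite sum_delta /entry mxE (can_eq (fidxK pframe)) mulr_natl; congr (_ *+ _).
  have [Gt _] := coset_trP sCG a.
  by rewrite mxtrace_mulC mulmxA -repr_mxM ?groupV // mulgV repr_mx1 mul1mx.
rewrite /mxtrace 2!big_distrr /=; apply: eq_bigr => i _.
rewrite (eq_bigr (fun j => (i == j)%:R * ((a == b)%:R * conj_hom a i j *
   (b == a')%:R))) => [|j _]; last by ring.
rewrite sum_delta; ring.
Qed.
End TraceRetract.

Local Open Scope classical_set_scope.

(** The evaluation of f, viewed as an element of X^* (x) X, is the trace of f, and
    is invertible. So the permutation module K is a direct summand
    of (K (x) X^* ) (x) X. *)
Lemma prime_perm_trace (P : set (stab k G)) (X : representation k G)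
    (f : mhom (res sCG X) (res sCG X)) : prime_ideal P ->
  \tr f != 0 -> P X -> P perm_rep.
Proof.
move=> pP nf PX.
have eqr : (\tr f)^-1 *: mhom_mx (tr_proj X) \is a equivariant
    (tens (tens perm_rep (dual X)) X) perm_rep.
  apply/equivariantP => x Gx; rewrite -scalemxAr -scalemxAl.
  by rewrite (mhomE (tr_proj X) Gx).
apply: (thick_retract (i := tr_inc f) (r := MHom eqr) (prime_thick pP)).
  by rewrite /= -scalemxAr tr_inc_proj scale_scalar_mx mulVf.
exact: prime_tensor pP (tens perm_rep (dual X) : stab k G) _ PX.
Qed.
End PermutationModule.

(** * The relative dimension of restriction *)

Section Main.
Local Open Scope ring_scope.
Local Open Scope classical_set_scope.
Variables (k : fieldType) (gT : finGroupType).
Implicit Types G H C : {group gT}.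

Lemma closure_res G H (sHG : H \subset G) (P Q : Spc (stab k H)) :
  (P : set _) `<=` (Q : set _) ->
  closure [set Spc_res sHG P] `<=` closure [set Spc_res sHG Q].
Proof.
move=> PQ R /closure_SpcP RP; apply/closure_SpcP.
by apply: subset_trans RP _ => M; apply: PQ.
Qed.

(** The generic points of a chain are nested primes R i. Their images are nested, and
    distinct by [Spc_res_incomparable], and the last one lies in supp A. *)
Lemma dim_shift_res G H (sHG : H \subset G) : dim_shift (stab_res k sHG) 0.
Proof.
move=> l A /set_dim_leP lA; rewrite addr0; apply/set_dim_leP => P n C PA [Cirr Clt] Cn.
have [R RC] : exists R : nat -> Spc (stab k H),
    forall i, (i <= n)%N -> C i = closure [set R i].
  suff : forall i, exists Q : Spc (stab k H), (i <= n)%N -> C i = closure [set Q].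
    by move=> /boolp.choice[R RC]; exists R.
  move=> i.
  have [ni|ni] := leqP i n; last by exists P.
  have [clC irrC] := Cirr i ni.
  have [Q CQ] := generic_pointP (e := triv_rep k H : stab k H)
    (fun Q => prime_unit (Spc_prime Q)) clC irrC.
  by exists Q.
have RP : closure [set R n] = closure [set P] by rewrite -RC.
have self (L : {group gT}) (Q : Spc (stab k L)) : closure [set Q] Q.
  exact/closure_SpcP.
have RnP : (P : set _) `<=` (R n : set _) by apply/closure_SpcP; rewrite RP.
have PRn : (R n : set _) `<=` (P : set _) by apply/closure_SpcP; rewrite -RP.
apply: (lA (Spc_res sHG P) n (fun i => closure [set Spc_res sHG (R i)])).
- exact: PA.
- split=> [i ni|i ni].
    by split; [exact: closed_closure | exact: closure_Spc_irr].
  have Rsub : (R i : set _) `<=` (R i.+1 : set _).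
    by apply/closure_SpcP; rewrite -RC //; apply: (Clt i ni).1; rewrite RC // ltnW.
  split; first exact: closure_res.
  move=> sub; have /closure_SpcP RR := sub _ (self _ _).
  apply: (Clt i ni).2; rewrite !RC ?(ltnW ni) // => Q /closure_SpcP QR.
  apply/closure_SpcP; apply: subset_trans QR _.
  exact: (Spc_res_incomparable (sHG := sHG)).
- by rewrite eqEsubset; split; apply: closure_res.
Qed.

(** With K = k[G/C] as at the top, dim (supp K) <= 0 while supp (Res K) is not
    empty, so that its dimension is at least 0. *)
Lemma dim_shift_res_ge0 G H p (sHG : H \subset G) (m : int) :
  p \in [pchar k] -> (p %| #|H|)%N -> dim_shift (stab_res k sHG) m -> 0 <= m.
Proof.
move=> char_k pH sm.
have pr_p := pcharf_prime char_k.
have [x Hx ox] := Cauchy pr_p pH.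
pose C := <[x]>%G.
have sCH : C \subset H by rewrite cycle_subG.
have sCG := fintype.subset_trans sCH sHG.
have C0 : #|C|%:R = 0 :> k := natr_card_cycle_eq0 char_k ox.
pose P0 : Spc (stab k C) := MkSpc (projectives_prime char_k ox).
pose K : stab k G := perm_rep k sCG.
(* No prime is strictly contained in a prime P of supp K, so that a chain which
   ends in the closure of P has length 0. *)
have K0 : dim_le (stab k G) 0 K.
  apply/set_dim_leP => P n D PK [Dirr Dlt] Dn.
  case: n Dirr Dlt Dn => [//|n] Dirr Dlt Dn.
  have maxP (Q : Spc (stab k G)) :
      (Q : set _) `<=` (P : set _) -> (P : set _) `<=` (Q : set _).
    move=> QP X PX.
    have pX : trace_projective (res sCG X).
      apply: contrapT => /(nonprojective_trace char_k ox)[f nf].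
      exact/PK/(prime_perm_trace (Spc_prime P) nf PX).
    have QKX : (Q : set _) (tens (perm_rep k sCG) X : stab k G).
      apply: (thick_zero (prime_thick (Spc_prime Q))).
      exact/stab_zeroP/trace_perm_tens.
    have [QK|//] := prime_prime (Spc_prime Q) QKX.
    by case: PK; apply: QP.
  (* A point Q of the first term is contained in P, hence equal to P, so the
     first term contains the last one. *)
  have [Dcl [[Q DQ] _]] := Dirr 0%N (leq0n _).
  have chain_mono0 i : (i <= n.+1)%N -> D 0%N `<=` D i.
    elim: i => [|i IH] iln; first exact: subset_refl.
    apply: subset_trans (IH (ltnW iln)) _.
    exact: (Dlt i iln).1.
  have /maxP PQ : (Q : set _) `<=` (P : set _).
    by apply/closure_SpcP; rewrite -Dn; apply: chain_mono0.
  have D1 : D 1%N `<=` D 0%N.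
    have clQ : closure [set Q] `<=` D 0%N.
      by rewrite [D 0%N](closure_id _).1 //; apply: closure_subset => _ ->.
    have chain_mono1 i : (i <= n)%N -> D 1%N `<=` D i.+1.
      elim: i => [|i IH] iln; first exact: subset_refl.
      exact: subset_trans (IH (ltnW iln)) (Dlt i.+1 iln).1.
    apply: subset_trans (chain_mono1 n (leqnn n)) _.
    rewrite Dn => R /closure_SpcP RP; apply: clQ; apply/closure_SpcP.
    exact: subset_trans RP PQ.
  by case: (Dlt 0%N isT).2.
have := sm _ _ K0; rewrite add0r => /set_dim_leP.
move=> /(_ (Spc_res sCH P0) 0%N (fun=> closure [set Spc_res sCH P0])); apply=> //.
- exact: (@perm_res_not_projective k gT G C sCG H sCH sHG C0).
- split=> [i _|//]; split; [exact: closed_closure | exact: closure_Spc_irr].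
Qed.
End Main.

Theorem theorem6p5p5 (gT : finGroupType) (G H : {group gT}) (k : fieldType)
    (p : nat) (sHG : H \subset G) (char_k : p \in [pchar k]%R)
    (p_dvd_G : p %| #|G|) (p_dvd_H : p %| #|H|) :
  has_relative_dimension (stab_res k sHG) (0%R : int).
Proof.
split=> [|m]; first exact: dim_shift_res.
exact: dim_shift_res_ge0 char_k p_dvd_H.
Qed.
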